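(* Let $K$ be a field and $c\ge 1$ an integer. Let $\mathbf{M}$ be a finitely generated graded $\mathrm{OI}$-module over $\mathbf{P} = (\mathbf{X}^{\mathrm{OI},1})^{\otimes c}$ or a finitely generated graded $\mathrm{FI}$-module over $\mathbf{P} = (\mathbf{X}^{\mathrm{FI},1})^{\otimes c}$. If $i \ge 0$ is any fixed integer, then there are integers $j_1 (\mathbf{M}, i) < \cdots < j_l (\mathbf{M}, i)$ and polynomials $p_1 (t),\ldots,p_l(t) \in \mathbb{Q}[t]$ such that, for all sufficiently large $n$, one has for the graded Betti numbers of $\mathbf{M}_n$ \[ \beta_{i, j}^{\mathbf{P}_n} (\mathbf{M}_n) = \begin{cases} 0 & \text{ if } j \notin \{j_1 (\mathbf{M}, i),\ldots,j_l (\mathbf{M}, i)\} \\ p_k (n) & \text{ if } j = j_k (\mathbf{M}, i) \text{ for some } k \in \{1,\dots,l\}. \end{cases} \]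
   Context: $\mathrm{OI}$ (resp. $\mathrm{FI}$) is the category with objects $[n] = \{1,\dots,n\}$, $n \ge 0$ ($[0]=\emptyset$), and morphisms the strictly increasing (resp. injective) maps $\varepsilon\colon [m]\to[n]$. The $\mathrm{OI}$-algebra $(\mathbf{X}^{\mathrm{OI},1})^{\otimes c}$ (resp. $\mathrm{FI}$-algebra $(\mathbf{X}^{\mathrm{FI},1})^{\otimes c}$) over $K$ is the functor $\mathbf{P}$ from $\mathrm{OI}$ (resp. $\mathrm{FI}$) to commutative $K$-algebras with $\mathbf{P}_n = K[x_{i,j} : 1\le i\le c,\ 1\le j\le n]$ (so $\mathbf{P}_0=K$) and, for $\varepsilon\colon[m]\to[n]$, $\varepsilon_*\colon \mathbf{P}_m\to\mathbf{P}_n$ the $K$-algebra homomorphism with $\varepsilon_*(x_{i,j}) = x_{i,\varepsilon(j)}$. Every variable has degree one. An $\mathrm{OI}$-module (resp. $\mathrm{FI}$-module) $\mathbf{M}$ over $\mathbf{P}$ is a functor from $\mathrm{OI}$ (resp. $\mathrm{FI}$) to $K$-vector spaces such that each $\mathbf{M}_n = \mathbf{M}([n])$ is a $\mathbf{P}_n$-module and $\mathbf{M}(\varepsilon)(aq) = \varepsilon_*(a)\,\mathbf{M}(\varepsilon)(q)$ for all $\varepsilon\colon[m]\to[n]$, $a\in\mathbf{P}_m$, $q\in\mathbf{M}_m$. It is graded if every $\mathbf{M}_n$ is a $\mathbb{Z}$-graded $\mathbf{P}_n$-module and every $\mathbf{M}(\varepsilon)$ is homogeneous of degree $0$. It is finitely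 generated if there is a finite subset of $\coprod_n \mathbf{M}_n$ not contained in any proper submodule (subfunctor compatible with the module structures). The graded Betti numbers are $\beta_{i,j}^{\mathbf{P}_n}(\mathbf{M}_n) = \dim_K[\mathrm{Tor}_i^{\mathbf{P}_n}(\mathbf{M}_n,K)]_j$, where $K$ is regarded as the quotient of $\mathbf{P}_n$ by the ideal generated by all variables and $[\ ]_j$ denotes the degree $j$ component. *)

(* Defs.v *)
From HB Require Import structures.
From mathcomp Require Import all_boot all_order all_algebra.
From mathcomp Require Import mpoly.
From mathcomp Require finmap monalg boolp.

Set Implicit Arguments.
Unset Strict Implicit.
Unset Printing Implicit Defensive.

Import Order.TTheory GRing.Theory Num.Theory.

Local Open Scope ring_scope.

(** * Graded modules over a standard graded polynomial ring *)

(* [gr d] is the set of homogeneous elements of degree [d], zero included.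
   Scalars of degree 0 are the constants, so each [gr d] is a [K]-subspace. *)
Record is_grading (K : fieldType) (N : nat) (M : lmodType {mpoly K[N]})
    (gr : int -> M -> Prop) : Prop := IsGrading {
  gr0 : forall d, gr d 0;
  grD : forall d x y, gr d x -> gr d y -> gr d (x + y);
  grZ : forall (e : nat) d (a : {mpoly K[N]}) x,
    a \is e.-homog -> gr d x -> gr (e%:Z + d) (a *: x);
  gr_sum : forall x, exists (s : seq int) (y : int -> M),
    (forall d, gr d (y d)) /\ x = \sum_(d <- s) y d;
  gr_direct : forall (s : seq int) (y : int -> M),
    uniq s -> (forall d, gr d (y d)) -> \sum_(d <- s) y d = 0 ->
    forall d, d \in s -> y d = 0
}.

Record gradedModule (K : fieldType) (N : nat) := GradedModule {
  gmod_sort :> lmodType {mpoly K[N]};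
  gpart : int -> gmod_sort -> Prop;
  gpartP : is_grading gpart
}.

Definition homogeneous_map (K : fieldType) (N : nat) (A B : gradedModule K N)
  (f : A -> B) : Prop := forall d x, gpart d x -> gpart d (f x).

(** * The residue field [K = K[x_1, ..., x_N] / (x_1, ..., x_N)] *)

(* A polynomial acts on [K] by multiplication by its constant term. *)
Definition residue_field (K : fieldType) (N : nat) : Type := K.

Section ResidueField.
Variables (K : fieldType) (N : nat).

Definition residue_scale (a : {mpoly K[N]}) (x : residue_field K N) :
  residue_field K N := a.@[fun=> 0] * x.

HB.instance Definition _ := GRing.Zmodule.copy (residue_field K N) K.

Fact residue_scaleA a b x :
  residue_scale a (residue_scale b x) = residue_scale (a * b) x.
Proof. by rewrite /residue_scale mevalM mulrA. Qed.

Fact residue_scale1 : left_id 1 residue_scale.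
Proof. by move=> x; rewrite /residue_scale meval1 mul1r. Qed.

Fact residue_scaleDr : right_distributive residue_scale +%R.
Proof. by move=> a x y; apply: mulrDr. Qed.

Fact residue_scaleDl x : {morph residue_scale^~ x : a b / a + b}.
Proof. by move=> a b; rewrite /residue_scale mevalD; apply: mulrDl. Qed.

HB.instance Definition _ := GRing.Zmodule_isLmodule.Build {mpoly K[N]}
  (residue_field K N) residue_scaleA residue_scale1 residue_scaleDr
  residue_scaleDl.

Definition residue_homog (d : int) (x : residue_field K N) : Prop :=
  d = 0 \/ x = 0.

Fact residue_homogP : is_grading residue_homog.
Proof.
split.
- by move=> d; right.
- move=> d x y [->|->] [hy|->]; rewrite ?add0r ?addr0.
  + by left.
  + by left.
  + by left.
  + by right.
- move=> e d a x ha [->|->]; last by right; rewrite scaler0.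
  case: e ha => [|e] ha; first by left.
  right; rewrite /GRing.scale /= /residue_scale.
  suff -> : a.@[fun=> 0] = 0 by rewrite mul0r.
  rewrite mevalE big_seq big1 // => m /(dhomog_mf ha) /= hm.

  have : m != 0%MM by rewrite -mdeg_eq0 hm.
  move=> nz; suff [k hk] : exists k, m k != 0%N.
    by rewrite (bigD1 k) //= expr0n (negPf hk) mul0r mulr0.
  apply/existsP; apply: contraNT nz; rewrite negb_exists => /forallP h.
  by apply/eqP/mnmP => k; rewrite mnm0E; apply/eqP; have := h k; rewrite negbK.
- move=> x; exists [:: 0], (fun d => if d == 0 then x else 0); split.
    by move=> d; case: eqP => [->|_]; [left | right].
  by rewrite big_seq1 eqxx.
- move=> s y us hy hs d ds; case: (hy d) => // d0; rewrite d0 in ds *.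
  rewrite (bigD1_seq 0) //= big1 ?addr0 in hs => // e e0.
  by case: (hy e) e0 => // ->; rewrite eqxx.
Qed.

Definition residue_gmod : gradedModule K N := GradedModule residue_homogP.

End ResidueField.

(** * Graded free resolutions, graded tensor products and [Tor] *)

Section Tor.
Variables (K : fieldType) (N : nat).
Local Notation S := {mpoly K[N]}.
Local Notation gmod := (gradedModule K N).

Record is_homogeneous_basis (F : gmod) (B : F -> Prop) : Prop := {
  basis_homog : forall b, B b -> exists d, gpart d b;
  basis_free : forall (s : seq F) (a : F -> S),
    uniq s -> (forall b, b \in s -> B b) -> \sum_(b <- s) a b *: b = 0 ->
    forall b, b \in s -> a b = 0;
  basis_span : forall x : F, exists (s : seq F) (a : F -> S),
    (forall b, b \in s -> B b) /\ x = \sum_(b <- s) a b *: b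
}.

Definition graded_free (F : gmod) : Prop :=
  exists B : F -> Prop, is_homogeneous_basis B.

Record graded_free_resolution (M : gmod) := GradedFreeResolution {
  res :> nat -> gmod;
  res_diff : forall k, {linear res k.+1 -> res k};
  res_aug : {linear res 0%N -> M};
  res_free : forall k, graded_free (res k);
  res_diff_homog : forall k, homogeneous_map (res_diff k);
  res_aug_homog : homogeneous_map res_aug;
  res_aug_surj : forall m, exists x, res_aug x = m;
  res_exact0 : forall x, res_aug x = 0 <-> exists y, x = res_diff 0 y;
  res_exactS : forall k x, res_diff k x = 0 <-> exists y, x = res_diff k.+1 y
}.

Definition is_tensor (A B T : lmodType S) (t : {bilinear A -> B -> T}) : Prop :=
  forall (U : lmodType S) (f : {bilinear A -> B -> U}),
  exists g : {linear T -> U}, (forall a b, g (t a b) = f a b) /\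
    forall g' : {linear T -> U}, (forall a b, g' (t a b) = f a b) -> g' =1 g.

Definition tensor_homog (A B : gmod) (T : lmodType S) (t : A -> B -> T)
    (j : int) (z : T) : Prop :=
  exists s : seq (A * B),
    (forall u, u \in s ->
       exists d e : int, [/\ gpart d u.1, gpart e u.2 & d + e = j]) /\
    z = \sum_(u <- s) t u.1 u.2.

(* The complex obtained by applying [- ⊗ L] to a resolution; as the tensor
   products are only given up to isomorphism, they are part of the data. *)
Record tensored_complex (M : gmod) (F : graded_free_resolution M) (L : gmod) :=
  TensoredComplex {
  tens :> nat -> lmodType S;
  tens_pure : forall k, {bilinear F k -> L -> tens k};
  tens_diff : forall k, {linear tens k.+1 -> tens k};
  tens_univ : forall k, is_tensor (tens_pure k);
  tens_diffE : forall k x a,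
    tens_diff k (tens_pure k.+1 x a) = tens_pure k (res_diff F k x) a
}.

(* [dim_K (Z / B) = b] for [K]-subspaces [B] of [Z]: there are [b] elements of
   [Z] whose classes form a basis of [Z / B]. *)
Definition has_subquotient_dim (V : lmodType S) (Z B : V -> Prop) (b : nat) :
    Prop :=
  exists v : 'I_b -> V,
    [/\ forall k, Z (v k),
        forall a : 'I_b -> K, B (\sum_k (a k)%:MP *: v k) -> forall k, a k = 0
      & forall z, Z z -> exists a : 'I_b -> K, B (z - \sum_k (a k)%:MP *: v k)].

Section Homology.
Variables (M L : gmod) (F : graded_free_resolution M).
Variable (C : tensored_complex F L).

Definition tens_cycle (i : nat) : C i -> Prop :=
  match i return C i -> Prop with
  | 0 => fun=> True
  | k.+1 => fun z => tens_diff C k z = 0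
  end.

Definition tens_cycles (i : nat) (j : int) (z : C i) : Prop :=
  tensor_homog (tens_pure C i) j z /\ tens_cycle z.

Definition tens_boundaries (i : nat) (j : int) (z : C i) : Prop :=
  exists2 w, tensor_homog (tens_pure C i.+1) j w & z = tens_diff C i w.

End Homology.

(* [dim_K [Tor_i(M, L)]_j = b].  Since [Tor] does not depend on the choice of
   the resolution nor of the tensor products, we ask for this dimension for all
   choices; [TensoredResolution.tensored_resolution_exists] below provides one for
   [L = K]. *)
Definition has_tor_dim (M L : gmod) (i : nat) (j : int) (b : nat) : Prop :=
  forall (F : graded_free_resolution M) (C : tensored_complex F L),
    has_subquotient_dim (@tens_cycles M L F C i j)
                        (@tens_boundaries M L F C i j) b.

Definition has_betti (M : gmod) (i : nat) (j : int) (b : nat) : Prop :=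
  has_tor_dim M (residue_gmod K N) i j b.

End Tor.

(** * Existence of graded free resolutions and of their tensor products *)

Module TensoredResolution.
Import finmap monalg boolp mpoly.
Local Open Scope ring_scope.

(* [monalg] redefines this notation in [type_scope]. *)
Local Notation "{ 'mpoly' T [ n ] }" := (mpoly n T) : type_scope.

Local Notation fcoef i f := (monalg.mcoeff i f).
Local Notation fsupp f := (@monalg.msupp _ _ f).
Local Notation fgen a i := (@monalg.mkmalgU _ _ i a).

(* The linear map from the free module on [T] with [i |-> v i]. *)
Section Ext.
Variables (R : nzRingType) (T : choiceType) (U : lmodType R) (v : T -> U).
Definition fext (f : {malg R[T]}) : U := \sum_(i <- fsupp f) fcoef i f *: v i.

Lemma fextw (d : {fset T}) f : (fsupp f `<=` d)%fset ->
  fext f = \sum_(i <- d) fcoef i f *: v i.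
Proof.
move=> h; rewrite /fext (big_fset_incl _ h) // => i _ hi.
by rewrite (monalg.mcoeff_outdom hi) scale0r.
Qed.

Lemma fext_linear : linear fext.
Proof.
move=> a f g; pose d := (fsupp f `|` fsupp g)%fset.
have hf : (fsupp f `<=` d)%fset by apply: fsubsetUl.
have hg : (fsupp g `<=` d)%fset by apply: fsubsetUr.
have hfg : (fsupp (a *: f + g) `<=` d)%fset.
  apply: fsubset_trans (monalg.msuppD_le _ _) _.
  by apply: fsetSU; apply: monalg.msuppZ_le.
rewrite (fextw hf) (fextw hg) (fextw hfg) scaler_sumr -big_split /=.
by apply: eq_bigr => i _; rewrite monalg.mcoeffD monalg.mcoeffZ scalerDl scalerA.
Qed.
HB.instance Definition _ :=
  GRing.isLinear.Build R {malg R[T]} U _ fext fext_linear.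

Lemma fextU a i : fext (fgen a i) = a *: v i.
Proof. by rewrite (fextw monalg.msuppU_le) big_seq_fset1 monalg.mcoeffUU. Qed.
End Ext.

Lemma malg_decomp (R : nzRingType) (T : choiceType) (f : {malg R[T]}) :
  f = \sum_(i <- fsupp f) fcoef i f *: fgen 1 i.
Proof.
rewrite {1}[f]monalg.monalgE; apply: eq_bigr => i _.
apply/malgP => j; rewrite monalg.mcoeffZ !monalg.mcoeffU.
by case: eqP => _; rewrite ?mulr1 ?mulr0.
Qed.

Section Grading.
Variables (K : fieldType) (N : nat).
Local Notation S := {mpoly K[N]}.
Local Notation gmod := (gradedModule K N).

Lemma sum_by_degree (M : lmodType S) (gr : int -> M -> Prop)
   (g0 : forall d, gr d 0)
   (gD : forall d x y, gr d x -> gr d y -> gr d (x + y)) (l : seq (int * M)) :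
  (forall u, u \in l -> gr u.1 u.2) ->
  exists (s : seq int) (y : int -> M), [/\ uniq s, (forall d, gr d (y d))
    & \sum_(u <- l) u.2 = \sum_(d <- s) y d].
Proof.
move=> hl; exists (undup (unzip1 l)), (fun d => \sum_(u <- l | u.1 == d) u.2).
split; first exact: undup_uniq.
  move=> d; rewrite big_seq_cond; elim/big_ind: _ => //; first exact: gD.
  by move=> u /andP[/hl + /eqP<-].
rewrite (exchange_big_dep xpredT) //= big_seq [RHS]big_seq.
apply: eq_bigr => u ul.
have ud : u.1 \in undup (unzip1 l) by rewrite mem_undup; apply: map_f.
rewrite -big_filter (_ : [seq _ <- _ | _] = [:: u.1]) ?big_seq1 //.
rewrite (@eq_filter _ _ (pred1 u.1)) ?filter_pred1_uniq ?undup_uniq //.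
Qed.

(* The free module on all homogeneous elements of [M]. *)
Section Cover.
Variable M : gmod.
Definition gens : choiceType := {x : int * M | `[< gpart x.1 x.2 >]}.
Definition gdeg (i : gens) : int := (val i).1.
Definition gval (i : gens) : M := (val i).2.
Lemma gvalP i : gpart (gdeg i) (gval i).
Proof. by have /asboolP := valP i. Qed.

Definition cover_part (d : int) (f : {malg S[gens]}) : Prop :=
  forall i m, (fcoef i f)@_m != 0 -> (mdeg m)%:Z + gdeg i = d.

Lemma cover_partD d f g :
  cover_part d f -> cover_part d g -> cover_part d (f + g).
Proof.
move=> hf hg i m; rewrite monalg.mcoeffD mcoeffD => h.
have [/eqP f0|] := boolP ((fcoef i f)@_m == 0); last exact: hf.
by apply: hg; rewrite f0 add0r in h.
Qed.

Lemma cover_grading : is_grading cover_part.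
Proof.
split.
- by move=> d i m; rewrite monalg.mcoeff0 mcoeff0 eqxx.
- exact: cover_partD.
- move=> e d a x ha hx i m; rewrite monalg.mcoeffZ mcoeffM => h.
  have : exists k : 'X_{1..N < (mdeg m).+1, (mdeg m).+1},
     (m == (k.1 + k.2)%MM) && (a@_k.1 * (fcoef i x)@_k.2 != 0).
    apply/existsP; apply: contraNT h; rewrite negb_exists => /forallP h.
    apply/eqP; apply: big1 => k hk; have := h k; rewrite hk /= negbK => /eqP-> //.
  move=> [[k1 k2] /= /andP[/eqP hm]]; rewrite mulf_eq0 negb_or => /andP[h1 h2].
  have := hx _ _ h2 => <-.
  move: (bmnm k1) (bmnm k2) h1 h2 hm => {}k1 {}k2 h1 h2 ->.
  rewrite mdegD PoszD -addrA; congr (Posz _ + _).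
  by apply: (dhomog_mf ha); rewrite mcoeff_msupp.
- move=> x.
  pose l := [seq (((mdeg m)%:Z + gdeg i), fgen ((fcoef i x)@_m *: 'X_[m]) i)
              | i <- fsupp x, m <- mpoly.msupp (fcoef i x)].
  have [|u /allpairsPdep[i [m [_ _ ->]]] j m' /=|s [y [_ hy hs]]] :=
    @sum_by_degree _ cover_part _ cover_partD l.
  + by move=> ? ? ?; rewrite monalg.mcoeff0 mcoeff0 eqxx.
  + rewrite monalg.mcoeffU; case: (i =P j) => [<-|_] /=;
      last by rewrite mulr0n mcoeff0 eqxx.
    by rewrite mulr1n mcoeffZ mcoeffX; case: (m =P m') => [->|];
      rewrite ?mulr0 ?eqxx.
  exists s, y; split => //; rewrite -hs /l big_allpairs_dep /=.
  rewrite {1}[x]monalg.monalgE; apply: eq_bigr => i _.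
  by rewrite -raddf_sum /= -mpolyE.
- move=> s y us hy hs d ds; apply/malgP => i; apply/mpolyP => m.
  rewrite monalg.mcoeff0 mcoeff0; apply/eqP; apply/negP => /negP h.
  have hd := hy _ _ _ h.
  have := congr1 (fun f => (fcoef i f)@_m) hs; rewrite /= monalg.mcoeff0 mcoeff0.
  rewrite raddf_sum raddf_sum /= (bigD1_seq d) //= big1 ?addr0.
    by move/eqP; rewrite (negPf h).
  move=> e ed; apply/eqP; apply/negP => /negP /hy he.
  by move: ed; rewrite -he hd eqxx.
Qed.

Definition cover : gmod := GradedModule cover_grading.

Definition cover_aug : {linear cover -> M} := @fext _ gens M gval.

Lemma cover_aug_homog : homogeneous_map cover_aug.
Proof.
move=> d x hx; rewrite /cover_aug /= /fext big_seq.
elim/big_ind: _ => [|a b|i hi].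
- exact: (gr0 (gpartP M)).
- exact: (grD (gpartP M)).
have : fcoef i x != 0 by rewrite monalg.mcoeff_neq0.
rewrite -mpoly.msupp_eq0; case e: (mpoly.msupp _) => [//|m0 r] _.
have hm0 : (fcoef i x)@_m0 != 0 by rewrite -mcoeff_msupp e mem_head.
rewrite -(hx _ _ hm0); apply: (grZ (gpartP M)) (gvalP i).
apply/dhomogP => m; rewrite mcoeff_msupp => /hx hm.
by move: hm; rewrite -(hx _ _ hm0) => /addIr [].
Qed.

Lemma cover_aug_surj x : exists f, cover_aug f = x.
Proof.
have [s [y [hy ->]]] := gr_sum (gpartP M) x.
pose i d : gens := Sub (d, y d) (asboolT (hy d)).
exists (\sum_(d <- s) fgen 1 (i d)); rewrite raddf_sum.
by apply: eq_bigr => d _; rewrite /= fextU scale1r.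
Qed.

Lemma cover_free : graded_free cover.
Proof.
exists (fun b => exists i : gens, b = fgen 1 i); split.
- move=> _ [i ->]; exists (gdeg i) => j m; rewrite monalg.mcoeffU.
  case: (i =P j) => [<-|_]; last by rewrite mulr0n mcoeff0 eqxx.
  by rewrite mulr1n mcoeff1; case: (m =P 0%MM) => [->|];
    rewrite ?mdeg0 ?add0r ?eqxx.
- move=> s a us hs h0 b bs; have [i bi] := hs _ bs.
  have := congr1 (fun f => fcoef i f) h0; rewrite /= monalg.mcoeff0 raddf_sum.
  rewrite /= (bigD1_seq b) //= monalg.mcoeffZ bi monalg.mcoeffUU mulr1.
  rewrite big_seq_cond big1 ?addr0 // => b' /andP[/hs[j ->] hj].
  rewrite monalg.mcoeffZ monalg.mcoeffU; case: (j =P i) hj => [->|_];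
    last by rewrite mulr0n mulr0.
  by rewrite eqxx.
- move=> x; pose t := [seq (fgen 1 i : cover) | i <- fsupp x].
  pose a (b : cover) := \sum_(i <- fsupp x | fgen 1 i == b) fcoef i x.
  have ginj : injective (fun i : gens => fgen (1 : S) i).
    move=> i j /(congr1 (fun f => fcoef i f)); rewrite /= !monalg.mcoeffU eqxx.
    by case: (j =P i) => // _ /eqP; rewrite mulr1n mulr0n oner_eq0.
  exists t, a; split; first by move=> _ /mapP[i _ ->]; exists i.
  rewrite big_map {1}[x]malg_decomp big_seq [RHS]big_seq.
  apply: eq_bigr => i hi; congr (_ *: _).
  rewrite /a -big_filter (@eq_filter _ _ (pred1 i)); last first.
    by move=> j /=; rewrite (inj_eq ginj).
  by rewrite filter_pred1_uniq ?fset_uniq // big_seq1.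
Qed.
End Cover.

Section Kernel.
Variables (A B : gmod) (f : {linear A -> B}) (fh : homogeneous_map f).
Definition kerp : {pred A} := fun x => f x == 0.
Fact kerp_closed : submod_closed kerp.
Proof.
split; first by rewrite unfold_in /kerp linear0.
move=> a x y; rewrite !unfold_in /kerp linearP => /eqP-> /eqP->.
by rewrite scaler0 addr0.
Qed.
HB.instance Definition _ := GRing.isSubmodClosed.Build _ _ kerp kerp_closed.
Record kert := Kert { kerv :> A; _ : kerv \in kerp }.
HB.instance Definition _ := [isSub for kerv].
HB.instance Definition _ := [Choice of kert by <:].
HB.instance Definition _ := [SubChoice_isSubLmodule of kert by <:].

Definition ker_part d (x : kert) := gpart d (val x).
Lemma ker_grading : is_grading ker_part.
Proof.
split.
- by move=> d; rewrite /ker_part raddf0; apply: (gr0 (gpartP A)).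
- by move=> d x y; rewrite /ker_part raddfD; apply: (grD (gpartP A)).
- by move=> e d a x ha; rewrite /ker_part linearZ; apply: (grZ (gpartP A)).
- move=> x; have [s0 [y0 [hy0 hx0]]] := gr_sum (gpartP A) (val x).
  have [|s [y [us hy hs]]] :=
    sum_by_degree (gr0 (gpartP A)) (@grD _ _ _ _ (gpartP A))
     (l := [seq (d, y0 d) | d <- s0]).
    by move=> _ /mapP[d _ ->]; apply: hy0.
  rewrite big_map -hx0 /= in hs.
  have hk d : d \in s -> f (y d) = 0.
    apply: (gr_direct (gpartP B) us (y := fun d => f (y d))).
      by move=> e; apply: fh.
    by rewrite -raddf_sum -hs; apply/eqP; apply: (valP x).
  exists s, (fun d => insubd 0 (y d)); split.
    move=> d; rewrite /ker_part val_insubd; case: ifP => _; first exact: hy.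
    by rewrite raddf0; apply: (gr0 (gpartP A)).
  apply: val_inj; rewrite raddf_sum /= hs; apply: eq_big_seq => d ds.
  by rewrite val_insubd unfold_in /kerp hk // eqxx.
- move=> s y us hy /(congr1 val); rewrite raddf_sum raddf0 => hs d ds.
  apply: val_inj; rewrite raddf0.
  exact: (gr_direct (gpartP A) us (y := fun d => val (y d))).
Qed.
Definition kergm : gmod := GradedModule ker_grading.
Definition ker_incl : {linear kergm -> A} := (val : kert -> A).
Lemma ker_incl_homog : homogeneous_map ker_incl. Proof. by []. Qed.
Lemma ker_inclP x : f x = 0 <-> exists z, x = ker_incl z.
Proof.
split=> [/eqP h|[z ->]]; last by apply/eqP; apply: (valP z).
by exists (Kert h).
Qed.
End Kernel.

Section Resolution.
Variable M : gmod.
Fixpoint syz k : gmod :=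
  if k is k'.+1 then kergm (@cover_aug_homog (syz k')) else M.
Definition cres k := cover (syz k).
Definition cdiff k : {linear cres k.+1 -> cres k} :=
  (ker_incl (@cover_aug_homog (syz k)) \o cover_aug (syz k.+1)).

Lemma cres_exactS k x : cdiff k x = 0 <-> exists y, x = cdiff k.+1 y.
Proof.
have -> : cdiff k x = 0 <-> cover_aug (syz k.+1) x = 0.
  split=> [h|h]; last by rewrite /cdiff /= h.
  by apply: val_inj; rewrite raddf0.
rewrite (ker_inclP (@cover_aug_homog (syz k.+1))); split=> -[].
  by move=> z ->; have [y <-] := @cover_aug_surj (syz k.+2) z; exists y.
by move=> y ->; exists (cover_aug (syz k.+2) y).
Qed.

Lemma cres_exact0 x : cover_aug M x = 0 <-> exists y, x = cdiff 0 y.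
Proof.
rewrite (ker_inclP (@cover_aug_homog M)); split=> -[].
  by move=> z ->; have [y <-] := @cover_aug_surj (syz 1) z; exists y.
by move=> y ->; exists (cover_aug (syz 1) y).
Qed.

Lemma cdiff_homog k : homogeneous_map (cdiff k).
Proof. by move=> d x hx; apply: (@cover_aug_homog (syz k.+1)). Qed.

Definition canonical_resolution : graded_free_resolution M :=
  @GradedFreeResolution K N M cres cdiff (cover_aug M)
    (fun k => cover_free (syz k)) cdiff_homog (@cover_aug_homog M)
    (@cover_aug_surj M) cres_exact0 cres_exactS.
End Resolution.

(* The tensor product of the free module on [T] with the residue field. *)
Definition tfree (T : choiceType) : Type := {malg K[T]}.
Section Tfree.
Variable T : choiceType.
HB.instance Definition _ := GRing.Zmodule.copy (tfree T) {malg K[T]}.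
Definition tscale (a : S) (x : tfree T) : tfree T :=
  a.@[fun=> 0] *: (x : {malg K[T]}).
Fact tscaleA a b x : tscale a (tscale b x) = tscale (a * b) x.
Proof. by rewrite /tscale mevalM scalerA. Qed.
Fact tscale1 : left_id 1 tscale.
Proof. by move=> x; rewrite /tscale meval1 scale1r. Qed.
Fact tscaleDr : right_distributive tscale +%R.
Proof. by move=> a x y; apply: scalerDr. Qed.
Fact tscaleDl x : {morph tscale^~ x : a b / a + b}.
Proof. by move=> a b; rewrite /tscale mevalD; apply: scalerDl. Qed.
HB.instance Definition _ := GRing.Zmodule_isLmodule.Build S (tfree T)
  tscaleA tscale1 tscaleDr tscaleDl.

Local Notation k0 := (residue_gmod K N).
Definition tpure (f : {malg S[T]}) (a : k0) : tfree T :=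
  @fext _ T (tfree T) (fun i => (fgen (a : K) i : tfree T)) f.

Fact tpure_bilinear :
  bilinear_for (GRing.Scale.Law.clone _ _ *:%R _)
    (GRing.Scale.Law.clone _ _ *:%R _) (tpure : {malg S[T]} -> k0 -> tfree T).
Proof.
split=> [a|f] s x y; first exact: fext_linear.
change (tpure f (s *: x + y) = s *: tpure f x + tpure f y).
rewrite /tpure /fext scaler_sumr -big_split; apply: eq_bigr => i _ /=.
rewrite scalerA mulrC -scalerA -scalerDr; congr (_ *: _).
apply/malgP => j; rewrite monalg.mcoeffD /GRing.scale /= /tscale.
rewrite monalg.mcoeffZ !monalg.mcoeffU /residue_scale.
by case: (i =P j) => _ /=; rewrite ?mulr1n ?mulr0n ?mulr0 ?addr0.
Qed.
HB.instance Definition _ := bilinear_isBilinear.Build _ _ _ _ _ _ tpure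
  tpure_bilinear.

Lemma tpureU i a : tpure (fgen 1 i) a = (fgen (a : K) i : tfree T).
Proof. by rewrite /tpure fextU scale1r. Qed.

Section Lift.
Variables (U : lmodType S) (f : {bilinear {malg S[T]} -> k0 -> U}).
Definition tlift (z : tfree T) : U :=
  \sum_(i <- fsupp z) f (fgen 1 i) (fcoef i z).
Lemma tliftw (d : {fset T}) z : (fsupp z `<=` d)%fset ->
  tlift z = \sum_(i <- d) f (fgen 1 i) (fcoef i z).
Proof.
move=> h; rewrite /tlift (big_fset_incl _ h) // => i _ hi.
by rewrite (monalg.mcoeff_outdom hi) linear0r.
Qed.
Lemma tlift_linear : linear tlift.
Proof.
move=> a x y; pose d := (fsupp x `|` fsupp y
  `|` fsupp ((a *: x : tfree T) + y : {malg K[T]}))%fset.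
rewrite (@tliftw d x) ?(@tliftw d y) ?(@tliftw d (a *: x + y)); first last.
- by rewrite /d -fsetUA fsubsetUl.
- by rewrite /d fsetUAC fsubsetUr.
- by rewrite /d fsubsetUr.
rewrite scaler_sumr -big_split; apply: eq_bigr => i _ /=.
rewrite monalg.mcoeffD {1}/GRing.scale /= /tscale monalg.mcoeffZ.
by rewrite -(linearPr f).
Qed.
HB.instance Definition _ :=
  GRing.isLinear.Build S (tfree T) U _ tlift tlift_linear.

Lemma tlift_pure x a : tlift (tpure x a) = f x a.
Proof.
rewrite {2}[x]malg_decomp /tpure /fext raddf_sum linear_sumlz.
apply: eq_bigr => i _ /=; rewrite linearZ /= (linearZl_LR f); congr (_ *: _).
by rewrite (tliftw monalg.msuppU_le) big_seq_fset1 monalg.mcoeffUU.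
Qed.
End Lift.

Lemma tfree_decomp (z : tfree T) :
  z = \sum_(i <- fsupp z) tpure (fgen 1 i) (fcoef i z).
Proof.
rewrite {1}[z]monalg.monalgE.
by apply: eq_bigr => i _; rewrite tpureU.
Qed.

Lemma tpure_univ : is_tensor (tpure : {bilinear {malg S[T]} -> k0 -> tfree T}).
Proof.
move=> U f; exists (tlift f); split; first exact: tlift_pure.
move=> g hg z; rewrite {1}[z]tfree_decomp raddf_sum.
by apply: eq_bigr => i _; apply: hg.
Qed.
End Tfree.

Section DiffTensor.
Variables (T1 T2 : choiceType) (d : {linear {malg S[T1]} -> {malg S[T2]}}).
Local Notation k0 := (residue_gmod K N).
Definition dpure (f : {malg S[T1]}) (a : k0) : tfree T2 := tpure (d f) a.
Fact dpure_bilinear :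
  bilinear_for (GRing.Scale.Law.clone _ _ *:%R _)
    (GRing.Scale.Law.clone _ _ *:%R _) (dpure : {malg S[T1]} -> k0 -> tfree T2).
Proof.
split=> [a|f] s x y; rewrite /dpure; last exact: linearPr.
by rewrite linearP linearPl.
Qed.
HB.instance Definition _ := bilinear_isBilinear.Build _ _ _ _ _ _ dpure
  dpure_bilinear.
End DiffTensor.

Lemma tensored_resolution_exists (M : gmod) :
  exists F : graded_free_resolution M,
    inhabited (tensored_complex F (residue_gmod K N)).
Proof.
exists (canonical_resolution M); constructor.
pose F k := gens (syz M k).
pose T k : lmodType S := tfree (F k).
pose t k : {bilinear cres M k -> residue_gmod K N -> T k} := @tpure (F k).
pose d k : {linear T k.+1 -> T k} :=
  tlift (@dpure (F k.+1) (F k) (cdiff M k)).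
refine (@TensoredComplex K N M (canonical_resolution M) (residue_gmod K N)
  T t d _ _).
- by move=> k; apply: tpure_univ.
- by move=> k x a; apply: tlift_pure.
Qed.
End Grading.

End TensoredResolution.

(** * The categories OI and FI *)

(* The object [[n] = {1, ..., n}] is represented by ['I_n]. *)
Variant index_category := OI | FI.

Definition is_morphism (C : index_category) (m n : nat)
    (f : {ffun 'I_m -> 'I_n}) : bool :=
  match C with
  | OI => [forall a : 'I_m, forall b : 'I_m, (a < b)%N ==> (f a < f b)%N]
  | FI => injectiveb f
  end.

Definition morph (C : index_category) (m n : nat) : Type :=
  {f : {ffun 'I_m -> 'I_n} | is_morphism C f}.

Definition morph_fun (C : index_category) (m n : nat) (e : morph C m n) :
  'I_m -> 'I_n := val e.

Fact morph_id_subproof (C : index_category) (n : nat) :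
  is_morphism C [ffun a : 'I_n => a].
Proof.
case: C => /=; first by do 2![apply/forallP => ?]; rewrite !ffunE implybb.
by apply/injectiveP => a b; rewrite !ffunE.
Qed.

Definition morph_id (C : index_category) (n : nat) : morph C n n :=
  Sub _ (morph_id_subproof C n).

Fact morph_comp_subproof (C : index_category) (m n p : nat)
    (g : morph C n p) (f : morph C m n) :
  is_morphism C [ffun a : 'I_m => morph_fun g (morph_fun f a)].
Proof.
case: C g f => -[g hg] [f hf]; rewrite /morph_fun /=.
  apply/forallP => a; apply/forallP => b; apply/implyP => ab; rewrite !ffunE.
  move/forallP/(_ a)/forallP/(_ b)/implyP/(_ ab): hf => fab.
  by move/forallP/(_ (f a))/forallP/(_ (f b))/implyP/(_ fab): hg.
apply/injectiveP => a b; rewrite !ffunE => /(injectiveP _ hg).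
exact: (injectiveP _ hf).
Qed.

Definition morph_comp (C : index_category) (m n p : nat)
    (g : morph C n p) (f : morph C m n) : morph C m p :=
  Sub _ (morph_comp_subproof g f).

(** * The algebra [P = (X^{OI,1})^{⊗c}], resp. [(X^{FI,1})^{⊗c}] *)

Section Algebra.
Variables (K : fieldType) (c : nat).


(* The variable [x_{i,j}]. *)
Definition pvar (n : nat) (i : 'I_c) (j : 'I_n) : {mpoly K[c * n]} :=
  'X_(mxvec_index i j).

(* The [K]-algebra map with [x_{i,j} |-> x_{i,e(j)}]; see [pushE]. *)
Definition push (C : index_category) (m n : nat) (e : morph C m n)
    (a : {mpoly K[c * m]}) : {mpoly K[c * n]} :=
  a \mPo [tuple mxvec (\matrix_(i < c, j < m) pvar i (morph_fun e j)) 0 k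
         | k < c * m].

Lemma pushE (C : index_category) (m n : nat) (e : morph C m n) i j :
  push e (pvar i j) = pvar i (morph_fun e j).
Proof.
by rewrite /push comp_mpolyXU -tnth_nth tnth_mktuple mxvecE mxE.
Qed.

End Algebra.

(** * Graded OI- and FI-modules over [P] *)

Record graded_imodule (C : index_category) (K : fieldType) (c : nat) :=
  GradedIModule {
  imod :> forall n, gradedModule K (c * n);
  imap : forall m n, morph C m n -> imod m -> imod n;
  imapD : forall m n (e : morph C m n) q r,
    imap e (q + r) = imap e q + imap e r;
  imapZ : forall m n (e : morph C m n) (a : {mpoly K[c * m]}) q,
    imap e (a *: q) = push e a *: imap e q;
  imap_id : forall n q, imap (morph_id C n) q = q;
  imap_comp : forall m n p (g : morph C n p) (f : morph C m n) q,
    imap (morph_comp g f) q = imap g (imap f q);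
  imap_homog : forall m n (e : morph C m n) d q,
    gpart d q -> gpart d (imap e q)
}.

Record is_submodule (C : index_category) (K : fieldType) (c : nat)
    (M : graded_imodule C K c) (Q : forall n, M n -> Prop) : Prop := {
  sub0 : forall n, Q n 0;
  subD : forall n q r, Q n q -> Q n r -> Q n (q + r);
  subZ : forall n (a : {mpoly K[c * n]}) q, Q n q -> Q n (a *: q);
  sub_map : forall m n (e : morph C m n) q, Q m q -> Q n (imap e q)
}.

Definition finitely_generated (C : index_category) (K : fieldType) (c : nat)
    (M : graded_imodule C K c) : Prop :=
  exists (r : nat) (w : 'I_r -> nat) (g : forall k, M (w k)),
    forall Q : forall n, M n -> Prop, is_submodule Q ->
      (forall k, Q (w k) (g k)) -> forall n q, Q n q.

(* Main.v *)
(** Over OI, the free module on generators of widths [w_k] has at level [n] the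
    [P_n]-basis of pairs of a generator [k] and a morphism [[w_k] -> [n]].  Its
    monomials, ordered by OI-divisibility, are words over the alphabet of columns
    of exponents, so Higman's lemma and leading terms show that every graded
    submodule is finitely generated.  Hence [M] has a resolution by finitely
    generated free OI-modules, whose level [n] is a graded free resolution of
    [M_n].  Modulo the variables, cycles and boundaries of a fixed homological
    and internal degree form OI-stable families of subspaces of [K^(basis)];
    their dimensions count leading terms, i.e. elements of an upward closed set
    of OI-morphisms, equivalently of 0-1 words with [w_k] ones closed under
    insertion of zeros.  Such counts are eventually polynomial, and only the
    degrees of the generators occur.  An FI-module is finitely generated over OI
    by the translates of its generators under permutations. *)

From HB Require Import structures.
From mathcomp Require Import all_boot all_order all_algebra.
From mathcomp Require Import boolp mpoly zify ring.
Require Import Defs.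

Set Implicit Arguments.
Unset Strict Implicit.
Unset Printing Implicit Defensive.

Import Order.TTheory GRing.Theory Num.Theory.

(** * Higman's lemma *)

(** [has_betti] quantifies over all graded free resolutions and all models of the tensor products. A
    dimension computed on the OI-resolution therefore has to be carried to an arbitrary choice;
    graded lifting, chain homotopies and the universal property of the tensor product serve this.
    The OI-resolution is not minimal, so a Betti number appears as a difference of two counts, the
    leading terms of the cycles minus those of the boundaries, and a listed degree may carry the
    zero polynomial. Everything rests on a total order of the terms that is compatible at once with
    multiplication by monomials and with all OI-morphisms. Permutations do not preserve such an
    order, which is why FI-modules are restricted to OI. Division by leading terms is carried out in
    one width and one degree at a time, where only finitely many terms occur; this gives
    termination. *)

Section Higman.
Variables (T : Type) (r : T -> T -> Prop).

Inductive embeds : seq T -> seq T -> Prop :=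
| embeds_nil l : embeds [::] l
| embeds_skip l l' y : embeds l l' -> embeds l (y :: l')
| embeds_cons l l' x y : r x y -> embeds l l' -> embeds (x :: l) (y :: l').

Definition increasing (f : nat -> nat) := forall i j, i < j -> f i < f j.

(** The well-quasi-order property in its infinite form: letters need a whole ascending subsequence,
    because the minimal bad sequence argument replaces infinitely many words at once. *)
Definition monotone_subsequences :=
  forall s : nat -> T, exists2 f, increasing f &
    forall i j, i < j -> r (s (f i)) (s (f j)).

Definition bad (s : nat -> seq T) := forall i j, i < j -> ~ embeds (s i) (s j).

Definition starts (l : seq (seq T)) (s : nat -> seq T) :=
  forall i, i < size l -> s i = nth [::] l i.

Definition extendable l := exists2 s, bad s & starts l s.

(** One greedy step towards a minimal bad sequence: among the possible next words a shortest one is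
    chosen. *)
Lemma minimal_bad_step l : extendable l -> exists x, extendable (rcons l x) /\
  forall y, extendable (rcons l y) -> size x <= size y.
Proof.
move=> [s bs ss].
have h : exists n, `[< exists x, extendable (rcons l x) /\ size x = n >].
  exists (size (s (size l))); apply/asboolP; exists (s (size l)); split=> //.
  exists s => // i; rewrite size_rcons ltnS leq_eqVlt => /orP[/eqP->|il].
    by rewrite nth_rcons ltnn eqxx.
  by rewrite nth_rcons il ss.
case: (ex_minnP h) => m /asboolP[x [ex sx]] hm; exists x; split=> // y ey.
by rewrite sx; apply: hm; apply/asboolP; exists y.
Qed.

(* Nash-Williams: in a minimal bad sequence, replacing the words from some
   point on by the tails of a subsequence with monotone heads would give a
   smaller bad sequence. *)
Lemma higman : monotone_subsequences ->
  forall s, exists i j, i < j /\ embeds (s i) (s j).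
Proof.
move=> hT s0; apply: contrapT => h0.
have bs0 : bad s0.
  by move=> i j ij e; apply: h0; exists i, j.
have e0 : extendable [::] by exists s0.
have /choice[g gP] : forall l, exists x, extendable l ->
    extendable (rcons l x) /\ forall y, extendable (rcons l y) -> size x <= size y.
  move=> l; have [el|nel] := pselect (extendable l); last by exists [::].
  by have [x hx] := minimal_bad_step el; exists x.
pose L := fix L n := if n is n'.+1 then rcons (L n') (g (L n')) else [::].
have eL n : extendable (L n).
  by elim: n => //= n IH; case: (gP _ IH).
have sL n : size (L n) = n by elim: n => //= n IH; rewrite size_rcons IH.
pose m n := g (L n).
have nL n i : i < n -> nth [::] (L n) i = m i.
  elim: n => // n IH; rewrite ltnS leq_eqVlt /= nth_rcons sL => /orP[/eqP->|il].
    by rewrite ltnn eqxx.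
  by rewrite il IH.
have bm : bad m.
  move=> i j ij; have [s bs ss] := eL j.+1.
  by rewrite -(nL j.+1 i) ?(leq_trans ij) // -(nL j.+1 j) // -!ss ?sL ?(leq_trans ij) //;
    apply: bs.
have mm n s : bad s -> (forall i, i < n -> s i = m i) -> size (m n) <= size (s n).
  move=> bs hs; case: (gP _ (eL n)) => _; apply; exists s => // i.
  rewrite size_rcons sL ltnS leq_eqVlt nth_rcons sL => /orP[/eqP->|il].
    by rewrite ltnn eqxx.
  by rewrite il nL // hs.
have mnil n : m n <> [::].
  by move=> mn; apply: (bm n n.+1) => //; rewrite mn; apply: embeds_nil.
have /choice[ht htP] : forall n, exists p, m n = p.1 :: p.2.
  by move=> n; case: (m n) (mnil n) => // x l _; exists (x, l).
have [f fi fr] := hT (fun n => (ht n).1).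
pose s i := if i < f 0 then m i else (ht (f (i - f 0))).2.
have tail_le l n : embeds l (ht n).2 -> embeds l (m n).
  by move=> h; rewrite htP; apply: embeds_skip.
have bs : bad s.
  move=> i j ij; rewrite /s; case: ltnP => hi; case: ltnP => hj.
  - exact: bm.
  (* An embedding into a tail is also one into the whole word [m (f (j - f 0))], whose index is at
     least [f 0], hence greater than [i]. *)
  - move/tail_le; apply: bm; apply: leq_trans hi _.
    by case: (posnP (j - f 0)) => [->//|h]; apply/ltnW/fi.
  - by rewrite ltnNge (leq_trans hi (ltnW ij)) in hj.
  - have ij' : i - f 0 < j - f 0 by rewrite ltn_sub2r // (leq_ltn_trans hi).
    move=> e; apply: (bm _ _ (fi _ _ ij'));
    rewrite (htP (f (i - f 0))) (htP (f (j - f 0))).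
    by apply: embeds_cons => //; apply: fr.
(* Minimality of [m] at position [f 0] is contradicted, since [s (f 0)] is [m (f 0)] without its
   head. *)
have : size (m (f 0)) <= size (s (f 0)).
  by apply: mm => // i il; rewrite /s il.
by rewrite /s ltnn subnn (htP (f 0)) /= ltnn.
Qed.

(** The matched positions are kept as a function on [nat], so that each constructor only shifts
    indices by one; [embeds_morph] turns them into an OI-morphism. *)
Lemma embeds_index x0 l l' : embeds l l' ->
  exists f : nat -> nat, [/\ forall i j, i < j < size l -> f i < f j,
    forall i, i < size l -> f i < size l' &
    forall i, i < size l -> r (nth x0 l i) (nth x0 l' (f i))].
Proof.
elim=> [{}l'|{}l {}l' y _ [f [f1 f2 f3]]|{}l {}l' x y xy _ [f [f1 f2 f3]]].
- by exists id; split=> // i j /andP[].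
- by exists (fun i => (f i).+1); split=> // i j; rewrite ltnS; apply: f1.
- exists (fun i => if i is i'.+1 then (f i').+1 else 0); split.
  + by case=> [|i] [|j] //=; rewrite !ltnS; apply: f1.
  + by case=> [|i] //=; rewrite !ltnS; apply: f2.
  + by case=> [|i] //=; rewrite !ltnS; apply: f3.
Qed.

End Higman.

(** Each chosen index is a position of a minimal value on the tail that remains after the previous
    one. *)
Lemma nat_monotone_subsequences : monotone_subsequences leq.
Proof.
move=> s.
have ex_min a : exists k, a <= k /\ forall j, a <= j -> s k <= s j.
  have h : exists n, `[< exists k, a <= k /\ s k = n >].
    by exists (s a); apply/asboolP; exists a.
  case: (ex_minnP h) => m /asboolP[k [ak <-]] hm; exists k; split=> // j aj.
  by apply: hm; apply/asboolP; exists j.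
have /choice[g gP] := ex_min.
pose f := fix f n := if n is n'.+1 then g (f n').+1 else g 0.
have fS n : f n < f n.+1 by rewrite /=; case: (gP (f n).+1).
have fi : increasing f.
  move=> i j; elim: j => // j IH; rewrite ltnS leq_eqVlt => /orP[/eqP->//|/IH h].
  exact: ltn_trans h (fS j).
exists f => // i j ij.
case: i ij => [|i] ij /=; first by have [_ h] := gP 0; apply: h.
have [_ h] := gP (f i).+1; apply: h.
exact: ltn_trans (fS i) (fi _ _ ij).
Qed.

(** Dickson's lemma: a further subsequence is extracted for each coordinate in turn. *)
Lemma fun_monotone_subsequences (I : finType) :
  monotone_subsequences (fun f g : I -> nat => forall i, f i <= g i).
Proof.
move=> s.
suff [f fi fP] : exists2 f, increasing f & forall i j, i < j ->
    forall k, k \in enum I -> s (f i) k <= s (f j) k.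
  by exists f => // i j ij k; apply: fP; rewrite ?mem_enum.
elim: (enum I) => [|k l [f fi fP]]; first by exists id => //.
have [g gi gP] := nat_monotone_subsequences (fun n => s (f n) k).
exists (f \o g) => [i j ij|i j ij k']; first by apply/fi/gi.
rewrite inE => /orP[/eqP->|k'l]; first exact: gP.
by apply: fP => //; apply: gi.
Qed.

(* Monotonicity of both a coordinate and its complement forces it to be
   constant. *)
Lemma fin_fun_monotone_subsequences (I J : finType) :
  monotone_subsequences (fun f g : J * (I -> nat) =>
    f.1 = g.1 /\ forall i, f.2 i <= g.2 i).
Proof.
move=> s.
pose t n (i : option (option I)) := match i with
  | None => enum_rank (s n).1 : nat
  | Some None => #|J| - enum_rank (s n).1
  | Some (Some i) => (s n).2 i end.
have [f fi fP] := fun_monotone_subsequences t; exists f => // i j ij; split.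
  apply: enum_rank_inj; apply: val_inj; apply/eqP; rewrite eqn_leq.
  rewrite (fP _ _ ij None) /=; have := fP _ _ ij (Some None) => /=.
  by rewrite leq_sub2lE // ltnW.
by move=> k; apply: (fP _ _ ij (Some (Some k))).
Qed.

(** * From good sequences to a finite basis *)

Section FiniteBasis.
Variables (T : Type) (r : T -> T -> Prop).

(** Otherwise one can go on choosing elements of [E] that lie above none of those already chosen,
    and the resulting sequence has no good pair. *)
Lemma finite_basis (E : T -> Prop) :
  (forall s : nat -> T, (forall n, E (s n)) -> exists i j, i < j /\ r (s i) (s j)) ->
  exists (k : nat) (b : 'I_k -> T), (forall i, E (b i)) /\
    forall x, E x -> exists i, r (b i) x.
Proof.
move=> hE; apply: contrapT => hn.
have step (l : seq T) : exists x, (forall i : 'I_(size l), E (tnth (in_tuple l) i)) ->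
    E x /\ forall i : 'I_(size l), ~ r (tnth (in_tuple l) i) x.
  (* [choice] asks for a value at every list, so a list with an entry outside [E] gets an arbitrary
     element. If [T] is empty, the list is empty and has no such entry. *)
  have [hl|] := pselect (forall i : 'I_(size l), E (tnth (in_tuple l) i)); last first.
    have [[x _]|nx] := pselect (exists x : T, True); first by exists x.
    case: l => [|x l]; last by case: nx; exists x.
    by move=> h; case: h => -[].
  apply: contrapT => hx; apply: hn.
  exists (size l), (tnth (in_tuple l)); split=> // x Ex.
  apply: contrapT => hr; apply: hx; exists x => _; split=> // i ri.
  by apply: hr; exists i.
have /choice[g gP] := step.
pose L := fix L n := if n is n'.+1 then rcons (L n') (g (L n')) else [::].
have sL n : size (L n) = n by elim: n => //= n IH; rewrite size_rcons IH.
have nL x0 n i : i < n -> nth x0 (L n) i = g (L i).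
  elim: n => // n IH; rewrite ltnS leq_eqVlt /= nth_rcons sL => /orP[/eqP->|il].
    by rewrite ltnn eqxx.
  by rewrite il IH.
have tL n (i : 'I_(size (L n))) : tnth (in_tuple (L n)) i = g (L i).
  by rewrite (tnth_nth (g [::])) nL // -[X in _ < X](sL n).
have EL n : E (g (L n)).
  have [m] := ubnP n; elim: m n => // m IH n; rewrite ltnS => nm.
  have [|//] := gP (L n); move=> i; rewrite tL; apply: IH.
  by rewrite (leq_trans _ nm) // -[X in _ < X](sL n).
have [i [j [ij]]] := hE (fun n => g (L n)) EL.
have [|_ h] := gP (L j); first by move=> k; rewrite tL.
have ij' : i < size (L j) by rewrite sL.
by have := h (Ordinal ij'); rewrite tL.
Qed.

End FiniteBasis.

(** * Eventually polynomial functions *)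

Section EventuallyPolynomial.
Local Open Scope ring_scope.

Definition evpoly (h : nat -> nat) := exists (p : {poly rat}) (n0 : nat),
  forall n, (n0 <= n)%N -> (h n)%:R = p.[n%:R].

Lemma eq_evpoly h h' : h =1 h' -> evpoly h -> evpoly h'.
Proof. by move=> e [p [n0 hp]]; exists p, n0 => n /hp; rewrite e. Qed.

Lemma evpoly_cst k : evpoly (fun=> k).
Proof. by exists k%:R%:P, 0%N => n _; rewrite hornerC. Qed.

Lemma evpolyD h1 h2 : evpoly h1 -> evpoly h2 -> evpoly (fun n => h1 n + h2 n)%N.
Proof.
move=> [p [n1 hp]] [q [n2 hq]]; exists (p + q), (maxn n1 n2) => n.
by rewrite geq_max hornerD => /andP[/hp<- /hq<-]; rewrite natrD.
Qed.

Lemma evpoly_sum (I : Type) (s : seq I) (h : I -> nat -> nat) :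
  (forall i, evpoly (h i)) -> evpoly (fun n => \sum_(i <- s) h i n)%N.
Proof.
move=> hh; elim: s => [|i s IH].
  by apply: eq_evpoly (evpoly_cst 0) => n; rewrite big_nil.
by apply: eq_evpoly (evpolyD (hh i) IH) => n; rewrite big_cons.
Qed.

(** The difference is expressed by an addition, to keep clear of truncated subtraction. *)
Lemma evpolyB h1 h2 h : (forall n, h n + h1 n = h2 n)%N ->
  evpoly h1 -> evpoly h2 -> evpoly h.
Proof.
move=> e [p [n1 hp]] [q [n2 hq]]; exists (q - p), (maxn n1 n2) => n.
by rewrite geq_max hornerD hornerN => /andP[/hp<- /hq<-]; rewrite -e natrD addrK.
Qed.

Lemma evpoly_unshift h : evpoly (fun n => h n.+1) -> evpoly h.
Proof.
move=> [p [n0 hp]]; exists (p \Po ('X - 1)), n0.+1 => -[//|n] /hp->.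
by rewrite horner_comp !hornerE -natr1 addrK.
Qed.

(** The difference of [X^(d+1)] is [(d+1) X^d] plus multiples of lower powers, whose antidifferences
    exist by induction. The division by [d+1] is where rational coefficients enter. *)
Lemma poly_antidifference (p : {poly rat}) :
  exists q : {poly rat}, forall x, q.[x + 1] - q.[x] = p.[x].
Proof.
have hX d : exists q : {poly rat}, forall x, q.[x + 1] - q.[x] = x ^+ d.
  have [m] := ubnP d; elim: m d => // m IH d; rewrite ltnS => dm.
  have hi (i : 'I_d) : exists q : {poly rat}, forall x, q.[x + 1] - q.[x] = x ^+ i.
    by apply: IH; apply: leq_trans dm.
  have [q hq] := fin_all_exists hi.
  exists (d.+1%:R^-1 *: ('X^(d.+1) - \sum_(i < d) q i *+ 'C(d.+1, i))) => x.
  have e : (x + 1) ^+ d.+1 =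
      x ^+ d.+1 + d.+1%:R * x ^+ d + \sum_(i < d) x ^+ i *+ 'C(d.+1, i).
    rewrite addrC exprDn !big_ord_recr /= binn subnn expr0 !mul1r mulr1n.
    rewrite binSn subSn // subnn expr1n mul1r mulr_natl.
    rewrite addrC [_ + _ *+ d.+1]addrC addrA; congr (_ + _).
    by apply: eq_bigr => i _; rewrite expr1n mul1r.
  have dn0 : d.+1%:R != 0 :> rat by rewrite pnatr_eq0.
  apply: (mulfI dn0); rewrite !hornerZ -mulrBr mulVKf //.
  rewrite !hornerD !hornerN !hornerXn !horner_sum e.
  have -> : \sum_(i < d) x ^+ i *+ 'C(d.+1, i) =
     \sum_(i < d) (q i *+ 'C(d.+1, i)).[x + 1] -
     \sum_(i < d) (q i *+ 'C(d.+1, i)).[x].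
    by rewrite -sumrB; apply: eq_bigr => i _; rewrite !hornerMn -mulrnBl hq.
  ring.
have [q hq] := fin_all_exists (fun i : 'I_(size p) => hX i).
exists (\sum_(i < size p) p`_i *: q i) => x.
rewrite !horner_sum -sumrB horner_coef; apply: eq_bigr => i _.
by rewrite !hornerZ -mulrBr hq.
Qed.

Lemma evpoly_antidifference g h : (forall n, h n.+1 = h n + g n)%N ->
  evpoly g -> evpoly h.
Proof.
move=> e [p [n0 hp]]; have [q hq] := poly_antidifference p.
(* An antidifference is fixed up to a constant, chosen here to give the right value at [n0]. *)
exists (q + ((h n0)%:R - q.[n0%:R])%:P), n0 => n; rewrite hornerD hornerC.
elim: n => [|n IH].
  by rewrite leqn0 => /eqP->; rewrite addrCA subrr addr0.
rewrite leq_eqVlt => /orP[/eqP<-|]; first by rewrite addrCA subrr addr0.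
rewrite ltnS => nn; rewrite e natrD IH // hp // -hq -natr1; ring.
Qed.

End EventuallyPolynomial.

(** * Counting words closed under insertion of zeros *)

Fixpoint bool_words n : seq (seq bool) :=
  if n is n'.+1 then map (cons false) (bool_words n') ++ map (cons true) (bool_words n')
  else [:: [::]].

Lemma mem_bool_words n s : (s \in bool_words n) = (size s == n).
Proof.
elim: n s => [|n IH] [|b s] //=; rewrite ?mem_cat.
  by apply/negbTE; rewrite negb_or; apply/andP; split; apply/mapP => -[].
rewrite eqSS -IH; apply/orP/idP => [[] /mapP[s' h []] _ -> //|h].
by case: b; [right|left]; apply: map_f.
Qed.

Lemma uniq_bool_words n : uniq (bool_words n).
Proof.
have ci b : injective (cons b : seq bool -> seq bool) by move=> s t [].
elim: n => //= n IH; rewrite cat_uniq !map_inj_uniq // IH /= andbT.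
by apply/hasPn => _ /mapP[s _ ->]; apply/mapP => -[].
Qed.

Definition count_words (d : nat) (U : seq bool -> Prop) n :=
  count (fun s => (count id s == d) && `[< U s >]) (bool_words n).

(** As both words have [d] ones, such an embedding inserts zeros only. *)
Definition word_upset (d : nat) (U : seq bool -> Prop) :=
  forall s t, embeds eq s t -> count id s = d -> count id t = d -> U s -> U t.

Lemma bool_monotone_subsequences : monotone_subsequences (@eq bool).
Proof.
move=> s; have [f fi fP] := fin_fun_monotone_subsequences
  (fun n => (s n, fun _ : 'I_1 => 0)).
by exists f => // i j /fP[].
Qed.

Lemma embeds_refl (T : Type) (r : T -> T -> Prop) l :
  (forall x, r x x) -> embeds r l l.
Proof. by move=> rr; elim: l => [|x l IH]; constructor. Qed.


Section CountWords.
Variables (d : nat) (U : seq bool -> Prop) (hU : word_upset d U).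

Local Definition after_zeros p s := U (nseq p false ++ s).

Local Lemma count_zeros p s : count id (nseq p false ++ s) = count id s.
Proof. by rewrite count_cat count_nseq mul0n. Qed.

Local Lemma embeds_zeros p s t : embeds eq s t ->
  embeds eq (nseq p false ++ s) (nseq p false ++ t).
Proof. by elim: p => // p IH h /=; apply: embeds_cons => //; apply: IH. Qed.

Local Lemma zerosS p s : after_zeros p (false :: s) = after_zeros p.+1 s.
Proof.
rewrite /after_zeros -cat1s catA (_ : _ ++ [:: false] = nseq p.+1 false) //.
by rewrite -(nseqD _ 1) addn1.
Qed.

Local Lemma zeros_sub p q s : p <= q -> count id s = d -> after_zeros p s -> after_zeros q s.
Proof.
move=> /subnKC <- sd; elim: (q - p) => [|k IH] h; first by rewrite addn0.
rewrite addnS; apply: hU (IH h); rewrite ?count_zeros //=.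
by apply: embeds_skip; apply: embeds_refl.
Qed.

(** If every [p] had a word [s p] that enters only at [p+1], Higman's lemma would give [i < j] with
    [s i] embedded in [s j]. Then [0^(i+1) s_i] in [U] forces [0^j s_j] in [U], a contradiction. One
    stationary step is enough to close the recurrence below. *)
Local Lemma zeros_stable : exists p, forall s,
  count id s = d -> after_zeros p.+1 s -> after_zeros p s.
Proof.
apply: contrapT => hn.
have /choice[s sP] : forall p, exists s,
    [/\ count id s = d, after_zeros p.+1 s & ~ after_zeros p s].
  move=> p; apply: contrapT => hs; apply: hn; exists p => s sd h.
  by apply: contrapT => hs'; apply: hs; exists s.
have [i [j [ij e]]] := higman bool_monotone_subsequences s.
have [di hi _] := sP i; have [dj _] := sP j; apply.
by apply: hU (zeros_sub ij di hi); rewrite ?count_zeros //; apply: embeds_zeros.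
Qed.

(** Write [W_q(n)] for the number of words counted for [after_zeros q]. The first letter gives
    [W_q(n+1) = W_(q+1)(n) + g_q(n)], where [g_q] counts the words starting with a one. At the
    stationary [p] this is a difference equation for [W_p]; smaller [q] follow by descending
    induction. *)
Lemma count_words_evpoly_step :
  (forall p, evpoly (fun n => count
    (fun s => ((count id s).+1 == d) && `[< after_zeros p (true :: s) >]) (bool_words n))) ->
  evpoly (count_words d U).
Proof.
move=> hg; have [p hp] := zeros_stable.
have rec q n : count_words d (after_zeros q) n.+1 = count_words d (after_zeros q.+1) n + count
    (fun s => ((count id s).+1 == d) && `[< after_zeros q (true :: s) >]) (bool_words n).
  rewrite /count_words /= count_cat !count_map; congr (_ + _).
  by apply: eq_count => s /=; rewrite zerosS.
suff : forall k, k <= p -> evpoly (count_words d (after_zeros (p - k))).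
  by move/(_ p (leqnn p)); rewrite subnn.
elim=> [_|k IH kp].
  rewrite subn0; apply: evpoly_antidifference (hg p) => n.
  rewrite rec; congr (_ + _); apply: eq_count => s.
  case: eqP => //= sd; apply/asboolP/asboolP => [/hp|]; first exact.
  exact: zeros_sub.
apply: evpoly_unshift; apply: eq_evpoly (evpolyD (IH (ltnW kp)) (hg (p - k.+1))) => n.
by rewrite rec subnSK.
Qed.

End CountWords.

(* Splitting off the first letter; the sets of words [s] with [0^p s] in [U]
   increase with [p], hence stabilize by Higman's lemma. *)
Lemma count_words_evpoly d U : word_upset d U -> evpoly (count_words d U).
Proof.
elim: d U => [|d IHd] U hU; apply: count_words_evpoly_step => // p.
  by apply: eq_evpoly (evpoly_cst 0) => n; rewrite [RHS]count_pred0.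
apply: eq_evpoly (IHd (fun s => U (nseq p false ++ true :: s)) _) => // s t e sd td.
apply: hU; rewrite ?count_cat ?count_nseq ?mul0n /= ?sd ?td //.
by elim: p => [|p IHp] /=; apply: embeds_cons.
Qed.

(** * Morphisms of OI *)

HB.instance Definition _ C m n := Finite.copy (morph C m n)
  {f : {ffun 'I_m -> 'I_n} | is_morphism C f}.

Lemma morph_ext C m n (e e' : morph C m n) : morph_fun e =1 morph_fun e' -> e = e'.
Proof. by move=> h; apply: val_inj; apply/ffunP. Qed.

Lemma morph_compE C m n p (g : morph C n p) (f : morph C m n) x :
  morph_fun (morph_comp g f) x = morph_fun g (morph_fun f x).
Proof. by rewrite /morph_fun /= ffunE. Qed.

Lemma morph_idE C n x : morph_fun (morph_id C n) x = x.
Proof. by rewrite /morph_fun /= ffunE. Qed.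

Lemma morph_compA C m n p q (h : morph C p q) (g : morph C n p) (f : morph C m n) :
  morph_comp h (morph_comp g f) = morph_comp (morph_comp h g) f.
Proof. by apply: morph_ext => x; rewrite !morph_compE. Qed.

Lemma morph_comp1 C m n (f : morph C m n) : morph_comp (morph_id C n) f = f.
Proof. by apply: morph_ext => x; rewrite morph_compE morph_idE. Qed.

Lemma morph_inj C m n (e : morph C m n) : injective (morph_fun e).
Proof.
case: C e => -[f hf]; rewrite /morph_fun /=; last exact/injectiveP.
move=> a b e; move: hf => /= /forallP hf; apply: val_inj; apply/eqP.
case: ltngtP => // ab.
  by have := implyP (forallP (hf a) b) ab; rewrite e ltnn.
by have := implyP (forallP (hf b) a) ab; rewrite e ltnn.
Qed.

Lemma morph_lt m n (e : morph OI m n) a b :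
  (morph_fun e a < morph_fun e b)%N = (a < b)%N.
Proof.
have h (x y : 'I_m) : (x < y)%N -> (morph_fun e x < morph_fun e y)%N.
  by have /= /forallP hf := valP e; apply: implyP; apply: (forallP (hf x) y).
case: (ltngtP a b) => [/h -> //|/h|/val_inj ->]; last by rewrite ltnn.
by move=> /ltnW; rewrite leqNgt => /negbTE.
Qed.

Lemma ex_morph_OI m n (f : 'I_m -> 'I_n) :
  (forall a b : 'I_m, (a < b)%N -> (f a < f b)%N) -> exists e : morph OI m n, morph_fun e =1 f.
Proof.
move=> hf; have h : is_morphism OI (finfun f).
  by apply/forallP => a; apply/forallP => b; apply/implyP; rewrite !ffunE; apply: hf.
by exists (Sub _ h) => x; rewrite /morph_fun /= ffunE.
Qed.

(** An increasing map satisfies [f x + k <= f (x + k)]. Going from [0] to [x] bounds [f x] below by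
    [x], and going from [x] to the last element bounds it above. *)
Lemma increasing_endo_id d (f : 'I_d -> 'I_d) :
  (forall a b : 'I_d, (a < b)%N -> (f a < f b)%N) -> f =1 id.
Proof.
move=> hf.
have h k (x y : 'I_d) : x + k = y :> nat -> (f x + k <= f y)%N.
  elim: k y => [|k IH] y; first by rewrite !addn0 => /val_inj ->.
  move=> e; have ltk : (x + k < d)%N by rewrite (leq_trans _ (ltn_ord y)) // -e addnS.
  rewrite addnS; apply: leq_ltn_trans (IH (Ordinal ltk) _) (hf _ _ _) => //=.
  by rewrite -e addnS.
move=> x; apply: val_inj; apply/eqP => /=; rewrite eqn_leq.
have d0 : (0 < d)%N by apply: leq_ltn_trans (ltn_ord x).
have dm : (d.-1 < d)%N by rewrite prednK.
have le_d (y : 'I_d) : (y <= d.-1)%N by rewrite -ltnS prednK.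
apply/andP; split.
  have := h (d.-1 - x)%N x (Ordinal dm); rewrite /= (subnKC (le_d x)) => /(_ erefl) hx.
  by rewrite -(leq_add2r (d.-1 - x)) (subnKC (le_d x)) (leq_trans hx) ?le_d.
by have := h x (Ordinal d0) x; rewrite add0n => /(_ erefl); apply: leq_trans; rewrite leq_addl.
Qed.

(** Inclusion of images suffices: [p] factors as [q] after an increasing endomorphism, which is the
    identity. *)
Lemma morph_eq_of_image d n (p q : morph OI d n) :
  (forall x, exists y, morph_fun p x = morph_fun q y) -> p = q.
Proof.
move=> /fin_all_exists [f hf]; apply: morph_ext => x.
rewrite hf; congr (morph_fun q _); apply: increasing_endo_id => a b.
by rewrite -(morph_lt p) !hf morph_lt.
Qed.

Definition mcodom C m n (e : morph C m n) : pred 'I_n :=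
  fun y => [exists x, morph_fun e x == y].

Lemma mcodomP C m n (e : morph C m n) y :
  reflect (exists x, y = morph_fun e x) (mcodom e y).
Proof. by apply: (iffP existsP) => -[x]; [move/eqP <- | move->]; exists x. Qed.

Lemma mcodom_comp C m n p (g : morph C n p) (f : morph C m n) y :
  mcodom (morph_comp g f) (morph_fun g y) = mcodom f y.
Proof.
apply/mcodomP/mcodomP => -[x h]; exists x; last by rewrite morph_compE h.
by apply: (@morph_inj _ _ _ g); rewrite -morph_compE.
Qed.

Lemma mcodom_eq d n (p q : morph OI d n) : mcodom p =1 mcodom q -> p = q.
Proof.
move=> h; apply: morph_eq_of_image => x; apply/mcodomP; rewrite -h.
by apply/mcodomP; exists x.
Qed.

Lemma card_mcodom C m n (e : morph C m n) : #|mcodom e| = m.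
Proof.
rewrite -[RHS]card_ord -(card_imset _ (@morph_inj _ _ _ e)); apply: eq_card => y.
by apply/mcodomP/imsetP => -[x]; exists x.
Qed.

(** This turns a comparison of 0-1 words into a factorization of OI-morphisms. *)
Lemma morph_comp_eq_of_codom d m n (p : morph OI d m) (q : morph OI d n) (e : morph OI m n) :
  (forall x, mcodom p x -> mcodom q (morph_fun e x)) -> morph_comp e p = q.
Proof.
move=> h; apply: morph_eq_of_image => x; rewrite morph_compE.
by apply/mcodomP/h/mcodomP; exists x.
Qed.

(** * Counting OI-morphisms in an upward closed set *)

Definition word_of d n (p : morph OI d n) : seq bool := [seq mcodom p y | y <- enum 'I_n].

Lemma size_word_of d n (p : morph OI d n) : size (word_of p) = n.
Proof. by rewrite size_map size_enum_ord. Qed.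

Lemma nth_word_of d n (p : morph OI d n) (y : 'I_n) : nth false (word_of p) y = mcodom p y.
Proof. by rewrite (nth_map y) ?size_enum_ord // nth_ord_enum. Qed.

Lemma count_word_of d n (p : morph OI d n) : count id (word_of p) = d.
Proof. by rewrite count_map -[RHS](card_mcodom p) cardE size_filter -enumT. Qed.

Lemma word_of_inj d n : injective (@word_of d n).
Proof. by move=> p q h; apply: mcodom_eq => y; rewrite -!nth_word_of h. Qed.

Lemma ex_word_of d n s : size s = n -> count id s = d ->
  exists p : morph OI d n, word_of p = s.
Proof.
move=> sn sd; pose A := [pred y : 'I_n | nth false s y].
have cA : #|A| = d.
  rewrite cardE size_filter -enumT -sd -[in RHS](mkseq_nth false s) sn /mkseq.
  by rewrite count_map -val_enum_ord count_map.
have s_sorted : sorted ltn (map val (enum A)).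
  rewrite [enum A]/enum_mem -enumT; apply: (@subseq_sorted _ _ ltn_trans _ (iota 0 n)).
    by rewrite -val_enum_ord; apply/map_subseq/filter_subseq.
  exact: iota_ltn_sorted.
have sz : size (map val (enum A)) = d by rewrite size_map -cardE cA.
have hf (x : 'I_d) : (x < #|A|)%N by rewrite cA.
have [p hp] : exists p : morph OI d n, forall x, morph_fun p x = enum_val (Ordinal (hf x)).
  apply: ex_morph_OI => a b ab.
  have x0 := enum_val (Ordinal (hf a)).
  rewrite !(enum_val_nth x0) -!(nth_map x0 (val x0) val) ?cA -?cardE ?cA //.
  by apply: (sorted_ltn_nth ltn_trans) => //; rewrite inE sz /=.
exists p; apply: (@eq_from_nth _ false) => [|i]; rewrite size_word_of ?sn // => hi.
rewrite (nth_word_of _ (Ordinal hi)) /=.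
apply/mcodomP/idP => [[x]|h].
  by rewrite hp => e; have := enum_valP (Ordinal (hf x)); rewrite -e.
have hA : Ordinal hi \in A by [].
have lt : (enum_rank_in hA (Ordinal hi) < d)%N by rewrite -cA.
exists (Ordinal lt); rewrite hp -[LHS](enum_rankK_in hA hA).
by congr enum_val; apply: val_inj.
Qed.

Lemma embeds_morph (T : Type) (r : T -> T -> Prop) m n (f : 'I_m -> T) (g : 'I_n -> T) :
  embeds r [seq f x | x <- enum 'I_m] [seq g y | y <- enum 'I_n] ->
  exists e : morph OI m n, forall x, r (f x) (g (morph_fun e x)).
Proof.
(* [embeds_index] takes a default letter, which [f ord0] supplies once the domain is nonempty. *)
case: m f => [|m] f h.
  by have [|e _] := @ex_morph_OI 0 n (fun x => match notF (ltn_ord x) with end);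
    [case | exists e => -[]].
have [k [k1 k2 k3]] := embeds_index (f ord0) h.
have sf : size [seq f x | x <- enum 'I_m.+1] = m.+1 by rewrite size_map size_enum_ord.
have sg : size [seq g y | y <- enum 'I_n] = n by rewrite size_map size_enum_ord.
rewrite sf in k1 k3; rewrite sf sg in k2.
have [|e he] := @ex_morph_OI m.+1 n (fun x => Ordinal (k2 x (ltn_ord x))).
  by move=> a b ab /=; apply: k1; rewrite ab ltn_ord.
exists e => x; have := k3 x (ltn_ord x).
rewrite he (nth_map x) ?size_enum_ord // nth_ord_enum.
set y := Ordinal _; rewrite (_ : k x = y :> nat) //.
by rewrite (nth_map y) ?size_enum_ord // nth_ord_enum.
Qed.

Lemma count_morph_evpoly d (U : forall n, morph OI d n -> Prop) :
  (forall m n (e : morph OI m n) p, U m p -> U n (morph_comp e p)) ->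
  evpoly (fun n => #|[pred p : morph OI d n | `[< U n p >]]|).
Proof.
move=> hU.
(* A word determines the width by its length and the morphism by its ones, so [V] loses no
   information about [U]. *)
pose V (s : seq bool) := exists n (p : morph OI d n), word_of p = s /\ U n p.
have VU n (p : morph OI d n) : V (word_of p) -> U n p.
  move=> [m [q [e Uq]]]; have em : m = n by rewrite -(size_word_of q) e size_word_of.
  by case: n / em p e => p /word_of_inj <-.
apply: (@eq_evpoly (count_words d V)); last first.
  apply: count_words_evpoly => s t e _ td [m [p [sp Up]]].
  have [q qt] := @ex_word_of d (size t) t erefl td.
  exists (size t), q; split=> //.
  have /embeds_morph[f hf] : embeds eq (word_of p) (word_of q) by rewrite sp qt.
  have <- : morph_comp f p = q by apply: morph_comp_eq_of_codom => x; rewrite hf.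
  exact: hU.
move=> n; rewrite /count_words -size_filter cardE -(size_map (@word_of d n)).
apply: perm_size; apply: uniq_perm; rewrite ?filter_uniq ?uniq_bool_words //.
  by rewrite map_inj_uniq ?enum_uniq //; apply: word_of_inj.
move=> s; rewrite mem_filter mem_bool_words; apply/idP/mapP.
  case/andP=> /andP[/eqP sd /asboolP Vs] /eqP sn.
  have [p hp] := ex_word_of sn sd; exists p => //; rewrite mem_enum inE.
  by apply/asboolP/VU; rewrite hp.
move=> [p]; rewrite mem_enum inE => /asboolP Up ->.
rewrite count_word_of size_word_of !eqxx !andbT; apply/asboolP.
by exists n, p.
Qed.

Local Open Scope ring_scope.

(** * Pushing monomials forward along a morphism *)

Section PushMonomial.
Variables (K : fieldType) (c : nat) (C : index_category).

(** The action of [push] on exponents. The fibres of [e] have at most one element, so the sum copies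
    the exponents on the image and is zero elsewhere. *)
Definition pushm m n (e : morph C m n) (u : 'X_{1..c * m}) : 'X_{1..c * n} :=
  [multinom mxvec (\matrix_(i < c, j' < n)
     (\sum_(j < m | morph_fun e j == j') u (mxvec_index i j))%N) ord0 k | k < c * n].

Lemma pushmE m n (e : morph C m n) u i j' : pushm e u (mxvec_index i j') =
  (\sum_(j < m | morph_fun e j == j') u (mxvec_index i j))%N.
Proof. by rewrite mnmE mxvecE mxE. Qed.

Lemma pushm_codom m n (e : morph C m n) u i j :
  pushm e u (mxvec_index i (morph_fun e j)) = u (mxvec_index i j).
Proof.
rewrite pushmE (big_pred1 j) // => j' /=; rewrite (inj_eq (@morph_inj _ _ _ e)) //.
Qed.

Lemma pushm_notin m n (e : morph C m n) u i j' : ~~ mcodom e j' ->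
  pushm e u (mxvec_index i j') = 0%N.
Proof.
move=> h; rewrite pushmE big1 // => j /eqP ej.
by case/negP: h; apply/mcodomP; exists j.
Qed.

Lemma mnm_eqP n (u v : 'X_{1..c * n}) :
  (forall i j, u (mxvec_index i j) = v (mxvec_index i j)) -> u = v.
Proof. by move=> h; apply/mnmP => k; case/mxvec_indexP: k. Qed.

Lemma pushm_inj m n (e : morph C m n) : injective (pushm e).
Proof. by move=> u v h; apply: mnm_eqP => i j; rewrite -!(pushm_codom e) h. Qed.

Lemma pushm0 m n (e : morph C m n) : pushm e 0%MM = 0%MM.
Proof. by apply: mnm_eqP => i j; rewrite pushmE big1 => [|j' _]; rewrite mnm0E. Qed.

Lemma pushm_id n u : pushm (morph_id C n) u = u.
Proof. by apply: mnm_eqP => i j; rewrite -{1}(morph_idE C j) pushm_codom. Qed.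

Lemma pushm_comp m n p (g : morph C n p) (f : morph C m n) u :
  pushm (morph_comp g f) u = pushm g (pushm f u).
Proof.
apply: mnm_eqP => i j'; have [/mcodomP[j ->]|ng] := boolP (mcodom g j').
  rewrite pushm_codom !pushmE; apply: eq_bigl => x.
  by rewrite morph_compE (inj_eq (@morph_inj _ _ _ g)).
rewrite (pushm_notin _ _ ng) pushm_notin //; apply: contra ng => /mcodomP[x ->].
by rewrite morph_compE; apply/mcodomP; exists (morph_fun f x).
Qed.

Lemma big_mxvec_index n (R : Type) (idx : R) (op : Monoid.com_law idx) (F : 'I_(c * n) -> R) :
  \big[op/idx]_k F k = \big[op/idx]_(i < c) \big[op/idx]_(j < n) F (mxvec_index i j).
Proof.
rewrite pair_big (reindex _ (curry_mxvec_bij _ _)) /=.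
by apply: eq_bigr => -[i j].
Qed.

Lemma mdeg_pushm m n (e : morph C m n) u : mdeg (pushm e u) = mdeg u.
Proof.
rewrite !mdegE !big_mxvec_index; apply: eq_bigr => i _.
rewrite [RHS](partition_big (morph_fun e) xpredT) //=.
by apply: eq_bigr => j _; rewrite pushmE.
Qed.

Lemma mpolyX_pairs n (u : 'X_{1..c * n}) : 'X_[u] =
  \prod_(i < c) \prod_(j < n) 'X_(mxvec_index i j) ^+ u (mxvec_index i j)
  :> {mpoly K[c * n]}.
Proof. by rewrite mpolyXE_id big_mxvec_index. Qed.

Lemma pushX m n (e : morph C m n) u : push e 'X_[u] = 'X_[pushm e u] :> {mpoly K[c * n]}.
Proof.
rewrite /push comp_mpolyX big_mxvec_index mpolyX_pairs; apply: eq_bigr => i _.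
rewrite [LHS](partition_big (morph_fun e) xpredT) //=.
apply: eq_bigr => j' _; rewrite pushmE -prodrXr.
by apply: eq_bigr => j /eqP <-; rewrite tnth_mktuple mxvecE mxE.
Qed.

Lemma pushD m n (e : morph C m n) : {morph @push K c C m n e : p q / p + q}.
Proof. by move=> p q; rewrite /push comp_mpolyD. Qed.

Lemma pushM m n (e : morph C m n) : {morph @push K c C m n e : p q / p * q}.
Proof. by move=> p q; rewrite /push rmorphM. Qed.

Lemma push0 m n (e : morph C m n) : push e 0 = 0 :> {mpoly K[c * n]}.
Proof. exact: raddf0. Qed.

Lemma push1 m n (e : morph C m n) : push e 1 = 1 :> {mpoly K[c * n]}.
Proof. exact: comp_mpoly1. Qed.

Lemma pushEX m n (e : morph C m n) (a : {mpoly K[c * m]}) :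
  push e a = \sum_(u <- msupp a) a@_u *: 'X_[pushm e u].
Proof.
rewrite {1}[a]mpolyE /push raddf_sum; apply: eq_bigr => u _ /=.
by rewrite comp_mpolyZ -pushX.
Qed.

Lemma push_mcoeff m n (e : morph C m n) (a : {mpoly K[c * m]}) u :
  (push e a)@_(pushm e u) = a@_u.
Proof.
rewrite pushEX raddf_sum {3}[a]mpolyE raddf_sum; apply: eq_bigr => v _ /=.
by rewrite !mcoeffZ !mcoeffX (inj_eq (@pushm_inj _ _ e)).
Qed.

Lemma push_supp m n (e : morph C m n) (a : {mpoly K[c * m]}) v :
  (push e a)@_v != 0 -> exists2 u, v = pushm e u & a@_u != 0.
Proof.
move=> h; have : exists2 u, u \in msupp a & v = pushm e u.
  apply: contrapT => hn; case/eqP: h; rewrite pushEX raddf_sum big_seq big1 //= => u ua.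
  rewrite mcoeffZ mcoeffX; case: eqP => [e'|]; rewrite ?mulr0 //.
  by case: hn; exists u.
by move=> [u ua e']; exists u => //; rewrite -mcoeff_msupp.
Qed.

Lemma push_id n (a : {mpoly K[c * n]}) : push (morph_id C n) a = a.
Proof. by apply/mpolyP => u; rewrite -{1}(pushm_id u) push_mcoeff. Qed.

Lemma push_comp m n p (g : morph C n p) (f : morph C m n) (a : {mpoly K[c * m]}) :
  push (morph_comp g f) a = push g (push f a).
Proof.
rewrite pushEX [push f a]pushEX {1}/push raddf_sum; apply: eq_bigr => u _ /=.
by rewrite comp_mpolyZ -/(push g _) pushX pushm_comp.
Qed.

End PushMonomial.

Lemma meval0E (K : fieldType) N (a : {mpoly K[N]}) : a.@[fun=> 0] = a@_0%MM.
Proof.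
rewrite [in LHS](mpolyE a) [in RHS](mpolyE a) !raddf_sum; apply: eq_bigr => m _ /=.
rewrite mevalZ mcoeffZ mevalX mcoeffX; congr (_ * _).
have [->|nz] := eqVneq m 0%MM; first by rewrite big1 // => i _; rewrite mnm0E.
have [k hk] : exists k, m k != 0%N.
  apply/existsP; apply: contraNT nz; rewrite negb_exists => /forallP h.
  by apply/eqP/mnmP => k; rewrite mnm0E; apply/eqP; have := h k; rewrite negbK.
by rewrite (bigD1 k) //= expr0n (negPf hk) mul0r.
Qed.

Lemma push_meval0 (K : fieldType) c C m n (e : morph C m n) (a : {mpoly K[c * m]}) :
  (push e a).@[fun=> 0] = a.@[fun=> 0].
Proof. by rewrite !meval0E -{1}(pushm0 _ e) push_mcoeff. Qed.

(** * Lexicographic comparison of functions *)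

Section Lex.
Variables (I : finType) (rk : I -> nat).

Definition lexlt (f g : I -> nat) : bool :=
  [exists p, (f p < g p)%N && [forall q, (rk q < rk p)%N ==> (f q == g q)]].

Lemma lexltP f g : reflect (exists p, (f p < g p)%N /\
  forall q, (rk q < rk p)%N -> f q = g q) (lexlt f g).
Proof.
apply: (iffP existsP) => -[p]; first case/andP=> fg /forallP h.
  by exists p; split=> // q qp; apply/eqP; apply: implyP qp.
by case=> fg h; exists p; rewrite fg; apply/forallP => q; apply/implyP => /h ->.
Qed.

Lemma lexlt_irr f : lexlt f f = false.
Proof. by apply/lexltP => -[p []]; rewrite ltnn. Qed.

Lemma lexlt_trans : injective rk -> transitive lexlt.
Proof.
move=> ri g f h /lexltP[p [fg Hp]] /lexltP[q [gh Hq]]; apply/lexltP.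
case: (ltngtP (rk p) (rk q)) => pq.
- exists p; split; first by rewrite -Hq.
  by move=> x xp; rewrite Hp // Hq // (ltn_trans xp).
- exists q; split; first by rewrite Hp.
  by move=> x xp; rewrite Hp ?Hq // (ltn_trans xp).
- exists p; move/ri: pq gh Hq => <- gh Hq; split; first exact: ltn_trans gh.
  by move=> x xp; rewrite Hp ?Hq.
Qed.

Lemma lexlt_total f g : injective rk -> lexlt f g \/ lexlt g f \/ f =1 g.
Proof.
move=> ri; have [/existsP[p0 hp0]|] := boolP [exists p, f p != g p]; last first.
  rewrite negb_exists => /forallP h; right; right => p.
  by apply/eqP; have := h p; rewrite negbK.
case: (@arg_minnP _ p0 (fun p => f p != g p) rk hp0) => p hp hmin.
have eq_q q : (rk q < rk p)%N -> f q = g q.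
  by move=> qp; apply/eqP; apply: contraLR qp => /hmin; rewrite -leqNgt.
case: (ltngtP (f p) (g p)) => fg; last by rewrite fg eqxx in hp.
  by left; apply/lexltP; exists p.
by right; left; apply/lexltP; exists p; split=> // q /eq_q.
Qed.

End Lex.

(** * Leading terms *)

Section LeadingTerms.
Variables (K : fieldType) (N : nat) (X : lmodType {mpoly K[N]}).
Variables (T : eqType) (lt : rel T) (cf : T -> X -> K).
Hypothesis lt_irr : irreflexive lt.
Hypothesis lt_trans : transitive lt.
Hypothesis lt_total : forall s t, s != t -> lt s t || lt t s.
Hypothesis cfD : forall t, {morph cf t : x y / x + y}.
Hypothesis cfZ : forall t a x, cf t (a%:MP *: x) = a * cf t x.
Hypothesis cf_eq0 : forall x, (forall t, cf t x = 0) -> x = 0.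
Hypothesis cf_supp : forall x, exists L : seq T, forall t, cf t x != 0 -> t \in L.

(** The abstract setting serves twice: for free modules, where [T] consists of terms, and for their
    reductions modulo the variables, where [T] is the basis. *)
Definition is_lead x t := cf t x != 0 /\ forall s, cf s x != 0 -> s != t -> lt s t.

Local Lemma cf0 t : cf t 0 = 0.
Proof. by rewrite -(scale0r (0 : X)) -mpolyC0 cfZ mul0r. Qed.

Local Lemma cf_sum t (I : Type) (s : seq I) (P : pred I) (F : I -> X) :
  cf t (\sum_(i <- s | P i) F i) = \sum_(i <- s | P i) cf t (F i).
Proof. by apply: (big_morph (cf t)); [apply: cfD | apply: cf0]. Qed.

Lemma seq_max (L : seq T) : L != [::] ->
  exists2 t, t \in L & forall s, s \in L -> s != t -> lt s t.
Proof.
elim: L => // x L IH _; have [->|/IH[t tL ht]] := eqVneq L [::].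
  by exists x; rewrite ?mem_head // => s; rewrite inE => /eqP ->; rewrite eqxx.
have [<-|/lt_total/orP[xt|tx]] := eqVneq t x.
- by exists t; rewrite ?mem_head // => s; rewrite inE => /orP[/eqP->|/ht//]; rewrite eqxx.
- exists x; rewrite ?mem_head // => s; rewrite inE => /orP[/eqP->|sL _].
    by rewrite eqxx.
  by have [->//|/(ht _ sL)/lt_trans] := eqVneq s t; apply.
- exists t; rewrite ?inE ?tL ?orbT // => s; rewrite inE => /orP[/eqP->//|].
  exact: ht.
Qed.

Lemma lead_exists x : x <> 0 -> exists t, is_lead x t.
Proof.
move=> xn0; have [L hL] := cf_supp x.
have [|t] := @seq_max [seq t <- L | cf t x != 0].
  apply/eqP => h; apply: xn0; apply: cf_eq0 => t; apply/eqP.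
  apply: contraT => ht; have : t \in [seq t <- L | cf t x != 0].
    by rewrite mem_filter ht hL.
  by rewrite h.
rewrite mem_filter => /andP[ht _] h; exists t; split=> // s hs st.
by apply: h; rewrite // mem_filter hs hL.
Qed.

Lemma lead_le x t s : is_lead x t -> cf s x != 0 -> s = t \/ lt s t.
Proof. by move=> [_ h] hs; have [|/(h _ hs)] := eqVneq s t; [left | right]. Qed.

(* Division: as all terms stay in the finite set [L], cancelling leading terms
   by elements of [V] terminates. *)
Lemma lead_division (L : seq T) (W V : X -> Prop) :
  (forall x t, W x -> cf t x != 0 -> t \in L) ->
  (forall x y a, W x -> W y -> W (x + a%:MP *: y)) ->
  V 0 -> (forall x y a, V x -> V y -> V (x + a%:MP *: y)) ->
  (forall x t, W x -> is_lead x t -> exists y, [/\ W y, V y & is_lead y t]) ->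
  forall x, W x -> V x.
Proof.
move=> WL WB V0 VD hlead x Wx.
(* The measure: [h t] is the rank of [t] in [L], and the induction is on a bound for the ranks of
   all terms of [x]. *)
pose h t := count (lt^~ t) L.
have [k] : exists k, forall t, cf t x != 0 -> (h t < k)%N.
  by exists (size L).+1 => t _; rewrite ltnS count_size.
elim: k x Wx => [|k IH] x Wx hx.
  suff -> : x = 0 by [].
  by apply: cf_eq0 => t; apply/eqP; apply: contraT => /hx.
have [->//|/eqP/lead_exists[t lt_x]] := eqVneq x 0.
have [y [Wy Vy lt_y]] := hlead _ _ Wx lt_x.
have cy : cf t y != 0 by case: lt_y.
pose a := cf t x / cf t y; pose z := x + (- a)%:MP *: y.
have Wz : W z by apply: WB.
have -> : x = z + a%:MP *: y.
  by rewrite /z -addrA -scalerDl -mpolyCD addNr mpolyC0 scale0r addr0.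
apply: VD => //; apply: IH => // s hs.
have st : lt s t.
  have : cf s x != 0 \/ cf s y != 0.
    have [e1|] := eqVneq (cf s x) 0; last by left.
    by right; move: hs; rewrite cfD cfZ e1 add0r mulf_eq0 negb_or => /andP[].
  have sn : s != t.
    by apply: contraNneq hs => ->; rewrite cfD cfZ mulNr /a divfK // subrr.
  by case=> [/(lead_le lt_x)|/(lead_le lt_y)] [/eqP|//]; rewrite (negbTE sn).
(* The rank drops strictly: whatever lies below [s] lies below [t], and [s] itself belongs to [L]
   and lies below [t] only. *)
have := hx t lt_x.1; rewrite ltnS; apply: leq_trans.
have sub : subpred (predU (lt^~ s) (pred1 s)) (lt^~ t).
  by move=> r /= /orP[/lt_trans|/eqP ->//]; apply.
apply: leq_trans (sub_count sub L).
rewrite -[X in (_ < X)%N]addn0 -(count_pred0 L).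
have <- : count (predI (lt^~ s) (pred1 s)) L = count pred0 L.
  by apply: eq_count => r /=; case: eqP => [->|]; rewrite ?lt_irr ?andbF.
rewrite count_predUI -addn1 leq_add2l -has_count; apply/hasP.
by exists s => //=; apply: WL Wz _.
Qed.

(* The basis of [Z / B] consists of one element of [Z] for each leading term
   of [Z] which is not a leading term of [B]. *)
Lemma subquotient_dim_lead (L : finType) (inc : L -> T) (Z B : X -> Prop) :
  injective inc ->
  (forall x t, Z x -> cf t x != 0 -> exists l, t = inc l) ->
  Z 0 -> B 0 ->
  (forall x y a, Z x -> Z y -> Z (x + a%:MP *: y)) ->
  (forall x y a, B x -> B y -> B (x + a%:MP *: y)) ->
  (forall x, B x -> Z x) ->
  exists b, (b + #|[pred l | `[< exists2 x, B x & is_lead x (inc l) >]]| =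
                 #|[pred l | `[< exists2 x, Z x & is_lead x (inc l) >]]|)%N /\
    has_subquotient_dim Z B b.
Proof.
move=> inc_inj ZL Z0 B0 ZD BD BZ.
set LB := [pred l | _]; set LZ := [pred l | _].
pose S := [pred l | LZ l && ~~ LB l]; exists #|S|; split.
  rewrite -(cardID LB LZ) addnC; congr (_ + _)%N; apply: eq_card => l.
    rewrite !inE /= andbC; case: asboolP => //= -[x Bx lx].
    by apply/esym/asboolP; exists x => //; apply: BZ.
  by rewrite !inE andbC.
have /fin_all_exists[v hv] (k : 'I_#|S|) : exists x, Z x /\ is_lead x (inc (enum_val k)).
  by have := enum_valP k; rewrite inE => /andP[/asboolP[x Zx lx] _]; exists x.
exists v; split=> [k|a Ba|z Zz]; first by case: (hv k).
- move=> k0; apply/eqP; apply: contraT => ak0.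
  (* The [v k] have distinct leading terms, so the largest one with nonzero coefficient leads the
     sum. As the sum lies in [B], that term would be in [LB], against the choice of [S]. *)
  have [|t] := @seq_max [seq inc (enum_val k) | k <- enum 'I_#|S| & a k != 0].
    apply/eqP => h; have : inc (enum_val k0) \in
        [seq inc (enum_val k) | k <- enum 'I_#|S| & a k != 0].
      by apply: map_f; rewrite mem_filter ak0 mem_enum.
    by rewrite h.
  case/mapP=> k; rewrite mem_filter => /andP[ak _] -> hmax {t}.
  have le_k s k' : a k' * cf s (v k') != 0 ->
      s = inc (enum_val k') \/ lt s (inc (enum_val k')).
    by rewrite mulf_eq0 negb_or => /andP[_]; apply: lead_le; case: (hv k').
  have le_max k' : a k' != 0 -> k' != k -> lt (inc (enum_val k')) (inc (enum_val k)).
    move=> ak' kk; apply: hmax; first by apply: map_f; rewrite mem_filter ak' mem_enum.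
    by rewrite (inj_eq inc_inj) (inj_eq enum_val_inj).
  have : ~~ LB (enum_val k) by have := enum_valP k; rewrite inE => /andP[].
  case/negP; apply/asboolP; exists (\sum_k (a k)%:MP *: v k) => //; split.
    rewrite cf_sum (bigD1 k) //= big1 => [|k' kk].
      by rewrite addr0 cfZ mulf_neq0 //; case: (hv k) => _ [].
    rewrite cfZ; apply/eqP; apply: contraT => h.
    have ak' : a k' != 0 by move: h; rewrite mulf_eq0 negb_or => /andP[].
    have lk := le_max _ ak' kk; case: (le_k _ _ h) => [e|lk'].
      by move: lk; rewrite e lt_irr.
    by have := lt_trans lk lk'; rewrite lt_irr.
  move=> s; rewrite cf_sum => hs sk.
  have [k' hk'] : exists k', cf s ((a k')%:MP *: v k') != 0.
    apply/existsP; apply: contraNT hs; rewrite negb_exists => /forallP h.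
    by rewrite big1 // => k' _; apply/eqP; have := h k'; rewrite negbK.
  rewrite cfZ in hk'.
  have ak' : a k' != 0 by move: hk'; rewrite mulf_eq0 negb_or => /andP[].
  have [ek|nk] := eqVneq k' k.
    by case: (le_k _ _ hk') => [e|]; rewrite ?ek //; rewrite e ek eqxx in sk.
  have lk := le_max _ ak' nk; case: (le_k _ _ hk') => [->//|lk'].
  exact: lt_trans lk' lk.
(* Spanning is a division inside [Z], whose target is the set of elements congruent modulo [B] to a
   combination of the [v k]. A leading term in [LB] is cancelled by an element of [B], any other one
   by some [v k]. *)
- apply: (@lead_division (map inc (enum L)) Z
      (fun z => exists a : 'I_#|S| -> K, B (z - \sum_k (a k)%:MP *: v k))) Zz => //.
  + by move=> x t Zx /(ZL _ _ Zx)[l ->]; apply: map_f; rewrite mem_enum.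
  + exists (fun=> 0); rewrite big1 ?subr0 // => k _.
    by rewrite mpolyC0 scale0r.
  + move=> x y c [a Ba] [a' Ba']; exists (fun k => a k + c * a' k).
    have -> : x + c%:MP *: y - \sum_k (a k + c * a' k)%:MP *: v k =
       (x - \sum_k (a k)%:MP *: v k) + c%:MP *: (y - \sum_k (a' k)%:MP *: v k).
      rewrite scalerBr scaler_sumr addrACA; congr (_ + _); rewrite -opprD; congr (- _).
      rewrite -big_split; apply: eq_bigr => k _ /=.
      by rewrite scalerA -mpolyCM mpolyCD scalerDl.
    exact: BD.
  + move=> x t Zx lx; have [l tl] := ZL x t Zx lx.1.
    have [/asboolP[y By ly]|nB] := boolP (LB l).
      exists y; rewrite tl; split=> //; first exact: BZ.
      exists (fun=> 0); rewrite big1 ?subr0 // => k _.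
      by rewrite mpolyC0 scale0r.
    have Sl : l \in S by rewrite inE nB andbT; apply/asboolP; exists x; rewrite -?tl.
    have [Zv lv] := hv (enum_rank_in Sl l).
    exists (v (enum_rank_in Sl l)); split=> //; last by rewrite enum_rankK_in // -tl in lv.
    exists (fun k => (k == enum_rank_in Sl l)%:R).
    rewrite (bigD1 (enum_rank_in Sl l)) //= eqxx mpolyC1 scale1r big1 ?addr0 ?subrr //.
    by move=> k /negbTE ->; rewrite mpolyC0 scale0r.
Qed.

End LeadingTerms.

(** * Monomials of finitely generated free OI-modules *)

Record oi_gens := OIGens {
  gen_idx : finType;
  gen_width : gen_idx -> nat;
  gen_deg : gen_idx -> int
}.

Definition basis (D : oi_gens) n := {k : gen_idx D & morph OI (gen_width k) n}.

HB.instance Definition _ D n := Finite.copy (basis D n)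
  {k : gen_idx D & morph OI (gen_width k) n}.

Section Monomials.
Variables (c : nat) (D : oi_gens).

Definition bdeg n (b : basis D n) : int := gen_deg (tag b).

Definition bmap m n (e : morph OI m n) (b : basis D m) : basis D n :=
  Tagged (fun k => morph OI (gen_width k) n) (morph_comp e (tagged b)).

Lemma bmap_id n b : bmap (morph_id OI n) b = b.
Proof. by case: b => k p; rewrite /bmap /= morph_comp1. Qed.

Lemma bmap_comp m n p (g : morph OI n p) (f : morph OI m n) b :
  bmap (morph_comp g f) b = bmap g (bmap f b).
Proof. by rewrite /bmap /= morph_compA. Qed.

Lemma bmap_inj m n (e : morph OI m n) : injective (bmap e).
Proof.
move=> [k p] [k' p'] /= h; have ek : k = k' by apply: (congr1 tag h).
case: k' / ek p' h => p' /eqP; rewrite -tag_eqE /tag_eq /= eqxx tagged_asE /=.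
move=> /eqP h; congr existT; apply: morph_ext => x.
by apply: (@morph_inj _ _ _ e); rewrite -!morph_compE h.
Qed.

Definition term n := (basis D n * 'X_{1..c * n})%type.

(** The term obtained from [t] by pushing along [e] and multiplying by [X^v]; these are the
    OI-multiples of [t]. *)
Definition act m n (e : morph OI m n) (v : 'X_{1..c * n}) (t : term m) : term n :=
  (bmap e t.1, (v + pushm e t.2)%MM).

(* Terms are compared by generator, then column by column, so that inserting
   columns preserves the order. *)
Definition pos n := option ('I_n * option 'I_c).

Definition key n (t : term n) (p : pos n) : nat :=
  match p with
  | None => enum_rank (tag t.1)
  | Some (j, None) => mcodom (tagged t.1) j
  | Some (j, Some i) => t.2 (mxvec_index i j)
  end.

(** Each column takes [c+1] consecutive ranks, its membership flag followed by its [c] exponents;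
    the successor leaves rank 0 to the generator. *)
Definition rk n (p : pos n) : nat :=
  match p with
  | None => 0
  | Some (j, None) => (j * c.+1).+1
  | Some (j, Some i) => (j * c.+1 + i.+1).+1
  end.

Lemma rk_inj n : injective (@rk n).
Proof.
have h (j j' : nat) (a a' : nat) : (a <= c)%N -> (a' <= c)%N ->
    (j * c.+1 + a = j' * c.+1 + a')%N -> j = j' /\ a = a'.
  move=> ac ac' e; have := congr1 (divn^~ c.+1) e; have := congr1 (modn^~ c.+1) e.
  by rewrite /= !modnMDl !modn_small // !divnMDl // !divn_small // !addn0.
move=> [[j [i|]]|] [[j' [i'|]]|] //= [].
- move=> /(h _ _ _ _ (ltn_ord i) (ltn_ord i'))[/val_inj -> [/val_inj ->]] //.
- by rewrite -[X in _ = X]addn0 => /(h _ _ _ _ (ltn_ord i) (leq0n c))[].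
- by rewrite -[X in X = _]addn0 => /(h _ _ _ _ (leq0n c) (ltn_ord i'))[].
- rewrite -[X in X = _]addn0 -[X in _ = X]addn0.
  by move=> /(h _ _ _ _ (leq0n c) (leq0n c))[/val_inj ->].
Qed.

Lemma key_inj n (t t' : term n) : key t =1 key t' -> t = t'.
Proof.
case: t t' => [[k p] u] [[k' p'] u'] h.
have ek : k = k' by apply: enum_rank_inj; apply: val_inj; apply: (h None).
case: k' / ek p' h => p' h.
have -> : p = p'.
  by apply: mcodom_eq => j; have /= := h (Some (j, None)); case: mcodom; case: mcodom.
by congr pair; apply: mnm_eqP => i j; apply: (h (Some (j, Some i))).
Qed.

Definition term_lt n (s t : term n) := lexlt (@rk n) (key s) (key t).

Lemma term_lt_irr n : irreflexive (@term_lt n).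
Proof. by move=> t; apply: lexlt_irr. Qed.

Lemma term_lt_trans n : transitive (@term_lt n).
Proof. by move=> t s r; apply/lexlt_trans/rk_inj. Qed.

Lemma term_lt_total n (s t : term n) : s != t -> term_lt s t || term_lt t s.
Proof.
move=> st; have [|[|/key_inj e]] := @lexlt_total _ _ (key s) (key t) (@rk_inj n).
- by rewrite /term_lt => ->.
- by rewrite /term_lt => ->; rewrite orbT.
- by rewrite e eqxx in st.
Qed.

(** Positions coming from level [m] through [pe] keep their relative order, and there [act] adds an
    amount [off] independent of the term. At the other positions the key does not depend on the term
    at all. So the first difference is carried to the first difference. *)
Lemma act_lt m n (e : morph OI m n) v s t :
  term_lt s t -> term_lt (act e v s) (act e v t).
Proof.
pose pe (p : pos m) : pos n :=
  if p is Some (j, i) then Some (morph_fun e j, i) else None.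
pose off (q : pos n) := if q is Some (j, Some i) then v (mxvec_index i j) else 0%N.
have key_act (r : term m) p : key (act e v r) (pe p) = (off (pe p) + key r p)%N.
  case: p => [[j [i|]]|] //=; first by rewrite mnmDE pushm_codom.
  by rewrite mcodom_comp.
have key_out (r : term m) j i : ~~ mcodom e j ->
    key (act e v r) (Some (j, i)) = off (Some (j, i)).
  case: i => [i|] ej /=; first by rewrite mnmDE pushm_notin // addn0.
  apply/eqP; rewrite eqb0; apply: contra ej => /mcodomP[x ->].
  by rewrite morph_compE; apply/mcodomP; exists (morph_fun (tagged r.1) x).
have rk_pe p q : (rk (pe q) < rk (pe p))%N -> (rk q < rk p)%N.
  case: p q => [[j i]|] [[j' i']|] //=; last by case: i.
  have := morph_lt e j j'; have := morph_lt e j' j.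
  case: (ltngtP j j') => [jj _ /idP h|jj|/val_inj -> _ _].
  - suff : (rk (pe (Some (j, i))) <= rk (pe (Some (j', i'))))%N.
      by rewrite /= leqNgt => /negbTE ->.
    have := leq_mul h (leqnn c.+1); rewrite mulSn /=.
    by case: i i' => [i|] [i'|] /=; try have := ltn_ord i; lia.
  - have := leq_mul jj (leqnn c.+1); rewrite mulSn /=.
    by case: i i' => [i|] [i'|] /=; try have := ltn_ord i'; lia.
  - by case: i i' => [i|] [i'|] /=; lia.
move=> /lexltP[p [kp hp]]; apply/lexltP; exists (pe p); split.
  by rewrite !key_act ltn_add2l.
move=> q; have [[q0 ->]|nq] := pselect (exists q0, q = pe q0).
  by move=> /rk_pe /hp h; rewrite !key_act h.
case: q nq => [[j i]|] nq _; last by case: nq; exists None.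
have nj : ~~ mcodom e j.
  by apply/negP => /mcodomP[x ej]; apply: nq; exists (Some (x, i)); rewrite ej.
by rewrite !key_out.
Qed.

(* A divisibility between monomials amounts to an embedding of words over the
   alphabet of columns. *)
Lemma term_wqo (s : nat -> {n : nat & term n}) : exists i j, (i < j)%N /\
  exists e v, tagged (s j) = act e v (tagged (s i)).
Proof.
(* A subsequence on which the generator is constant; the index type ['I_0] leaves only the finite
   component to be compared. *)
have [f fi fP] := fin_fun_monotone_subsequences
  (fun n => (tag (tagged (s n)).1, fun _ : 'I_0 => 0%N)).
pose col n (t : term n) (j : 'I_n) :=
  (mcodom (tagged t.1) j : bool, fun i => t.2 (mxvec_index i j)).
pose r (x y : bool * ('I_c -> nat)) := x.1 = y.1 /\ forall i, (x.2 i <= y.2 i)%N.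
have [i [j [ij h]]] := @higman _ r (@fin_fun_monotone_subsequences _ _)
  (fun n => [seq col _ (tagged (s (f n))) y | y <- enum 'I_(tag (s (f n)))]).
exists (f i), (f j); split; first exact: fi.
have [e he] := embeds_morph h.
have [/= ek _] := fP _ _ ij.
move: (s (f i)) (s (f j)) ek e he {h} => [m [[k p] u]] [n [[k' p'] u']] /= ek.
case: k' / ek p' => p' e he.
have le_u : (pushm e u <= u')%MM.
  apply/mnm_lepP => x; case/mxvec_indexP: x => a y.
  have [/mcodomP[x ->]|ny] := boolP (mcodom e y); last by rewrite pushm_notin.
  by rewrite pushm_codom; apply: (he x).2.
exists e, (u' - pushm e u)%MM; rewrite /act /= submK //; congr (_, _).
rewrite /bmap /=; congr existT; apply/esym.
by apply: morph_comp_eq_of_codom => x; have [/= -> _] := he x.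
Qed.

End Monomials.

(** * Finitely generated free OI-modules *)

Lemma mcoeffM_neq0 (R : nzRingType) N (a b : {mpoly R[N]}) m : (a * b)@_m != 0 ->
  exists u v, [/\ m = (u + v)%MM, a@_u != 0 & b@_v != 0].
Proof.
rewrite mcoeffM => h.
have [[k1 k2] /= /andP[/eqP hm hk]] : exists k : 'X_{1..N < (mdeg m).+1, (mdeg m).+1},
   (m == (k.1 + k.2)%MM) && (a@_k.1 * b@_k.2 != 0).
  apply/existsP; apply: contraNT h; rewrite negb_exists => /forallP h.
  by apply/eqP; apply: big1 => k hk; have := h k; rewrite hk /= negbK => /eqP-> //.
exists k1, k2; split=> //; first by apply: contraNneq hk => ->; rewrite mul0r.
by apply: contraNneq hk => ->; rewrite mulr0.
Qed.

Section Free.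
Variables (K : fieldType) (c : nat) (D : oi_gens).

Definition fmod n := {ffun basis D n -> {mpoly K[c * n]}^o}.

Definition fpart n (d : int) (f : fmod n) :=
  forall b u, (f b : {mpoly K[c * n]})@_u != 0 -> (mdeg u)%:Z + bdeg b = d.

Definition fcomp n (d : int) (f : fmod n) : fmod n :=
  [ffun b => \sum_(u <- msupp (f b : {mpoly K[c * n]}) | (mdeg u)%:Z + bdeg b == d)
     (f b : {mpoly K[c * n]})@_u *: 'X_[u] : {mpoly K[c * n]}].

Lemma fcompE n d (f : fmod n) b u : (fcomp d f b : {mpoly K[c * n]})@_u =
  if (mdeg u)%:Z + bdeg b == d then (f b : {mpoly K[c * n]})@_u else 0.
Proof.
rewrite ffunE raddf_sum /=.
have [us|/memN_msupp_eq0 us] := boolP (u \in msupp (f b : {mpoly K[c * n]})).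
  rewrite -big_filter; case: ifP => hu.
    rewrite (bigD1_seq u) ?filter_uniq ?msupp_uniq ?mem_filter ?hu //=.
    rewrite mcoeffZ mcoeffX eqxx mulr1 big1 ?addr0 // => v /negbTE vu.
    by rewrite mcoeffZ mcoeffX vu mulr0.
  rewrite big_seq big1 // => v; rewrite mem_filter => /andP[hv _].
  rewrite mcoeffZ mcoeffX; case: eqP => [e|]; last by rewrite mulr0.
  by rewrite e hu in hv.
rewrite us if_same big1_seq // => v /andP[_ vs].
rewrite mcoeffZ mcoeffX; case: eqP => [e|]; last by rewrite mulr0.
by rewrite e us mul0r.
Qed.

Lemma fmodP n (f g : fmod n) :
  (forall b u, (f b : {mpoly K[c * n]})@_u = (g b : {mpoly K[c * n]})@_u) -> f = g.
Proof. by move=> h; apply/ffunP => b; apply/mpolyP => u; apply: h. Qed.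

Lemma fmod_sumE n (I : Type) (s : seq I) (P : pred I) (F : I -> fmod n) b :
  (\sum_(i <- s | P i) F i) b = \sum_(i <- s | P i) F i b.
Proof. by elim/big_rec2: _ => [|i x y _ <-]; rewrite ffunE. Qed.

Lemma fpart_grading n : @is_grading K (c * n) (fmod n) (@fpart n).
Proof.
split.
- by move=> d b u; rewrite ffunE mcoeff0 eqxx.
- move=> d x y hx hy b u; rewrite ffunE mcoeffD => h.
  have [e|] := eqVneq ((x b : {mpoly K[c * n]})@_u) 0; last exact: hx.
  by apply: hy; rewrite e add0r in h.
- move=> e d a x /dhomogP ha hx b u; rewrite ffunE => /mcoeffM_neq0[u1 [u2 [-> h1 h2]]].
  rewrite mdegD PoszD -addrA (hx _ _ h2); congr (Posz _ + _).
  by apply: ha; rewrite mcoeff_msupp.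
- move=> x; pose s := undup (flatten [seq [seq (mdeg u)%:Z + bdeg b
      | u <- msupp (x b : {mpoly K[c * n]})] | b <- enum {: basis D n}]).
  exists s, (fun d => fcomp d x); split.
    by move=> d b u; rewrite fcompE; case: ifP => [/eqP //|_]; rewrite eqxx.
  apply: fmodP => b u; rewrite fmod_sumE raddf_sum /=.
  under eq_bigr do rewrite fcompE.
  have [us|/memN_msupp_eq0 us] := boolP (u \in msupp (x b : {mpoly K[c * n]})).
    rewrite (bigD1_seq ((mdeg u)%:Z + bdeg b)) ?undup_uniq //=.
      by rewrite eqxx big1 ?addr0 // => d; rewrite eq_sym => /negbTE ->.
    rewrite mem_undup; apply/flattenP; exists [seq (mdeg u)%:Z + bdeg b
      | u <- msupp (x b : {mpoly K[c * n]})]; last exact: map_f.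
    by apply/mapP; exists b; rewrite ?mem_enum.
  by rewrite us big1 // => d _; rewrite if_same.
- move=> s y us hy h d ds; apply: fmodP => b u; rewrite ffunE mcoeff0.
  apply/eqP; apply: contraT => hd; have e := hy _ _ _ hd.
  have := congr1 (fun f : fmod n => (f b : {mpoly K[c * n]})@_u) h.
  rewrite fmod_sumE raddf_sum /= (bigD1_seq d) //= ffunE mcoeff0 big1 ?addr0.
    by move/eqP; rewrite (negbTE hd).
  move=> d' dd; apply/eqP; apply: contraT => /hy e'.
  by rewrite -e' e eqxx in dd.
Qed.

Definition free_gmod n : gradedModule K (c * n) := GradedModule (@fpart_grading n).

Definition fdelta n (b : basis D n) : fmod n := [ffun b' => (b' == b)%:R].

Lemma fmod_decomp n (f : fmod n) : f = \sum_b f b *: fdelta b.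
Proof.
apply/ffunP => b; rewrite fmod_sumE (bigD1 b) //= big1 => [|b' bb].
  by rewrite !ffunE eqxx addr0 /GRing.scale /= mulr1.
by rewrite !ffunE eq_sym (negbTE bb) scaler0.
Qed.

Lemma fdelta_part n (b : basis D n) : fpart (bdeg b) (fdelta b).
Proof.
move=> b' u; rewrite ffunE; case: (b' =P b) => [->|_]; last first.
  by rewrite mulr0n mcoeff0 eqxx.
rewrite mulr1n mcoeff1; case: (u =P 0%MM) => [->|_]; last by rewrite eqxx.
by rewrite mdeg0 add0r.
Qed.

Lemma free_graded_free n : graded_free (free_gmod n).
Proof.
exists (fun x => exists b, x = fdelta b); split.
- by move=> _ [b ->]; exists (bdeg b); apply: fdelta_part.
- move=> s a us hs h x xs; have [b eb] := hs x xs.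
  have := congr1 (fun f : fmod n => f b) h; rewrite /= fmod_sumE.
  rewrite (bigD1_seq x) //= big_seq_cond big1 => [|y /andP[/hs[b' ->] nb]].
    by rewrite eb !ffunE eqxx addr0 /GRing.scale /= mulr1.
  have nbb : (b == b') = false by apply: contraNF nb => /eqP <-; rewrite eb.
  by rewrite !ffunE nbb scaler0.
- move=> x; have inj : injective (@fdelta n).
    move=> b b' /ffunP /(_ b); rewrite !ffunE eqxx; case: eqP => // _ /eqP.
    by rewrite oner_eq0.
  (* Coefficients are indexed by the elements of the basis, so [fdelta] has to be inverted; by
     injectivity the sum has a single summand. *)
  pose a (y : fmod n) : {mpoly K[c * n]} := \sum_(b | fdelta b == y) x b.
  exists [seq fdelta b | b <- enum {: basis D n}], a; split.
    by move=> _ /mapP[b _ ->]; exists b.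
  rewrite {1}[x]fmod_decomp big_map big_enum; apply: eq_bigr => b _ /=.
  by rewrite /a (big_pred1 b) // => b' /=; rewrite (inj_eq inj).
Qed.

Definition fpush m n (e : morph OI m n) (f : fmod m) : fmod n :=
  \sum_b (push e (f b) : {mpoly K[c * n]}) *: fdelta (bmap e b).

Lemma fpush_bmap m n (e : morph OI m n) f b : fpush e f (bmap e b) = push e (f b).
Proof.
rewrite /fpush fmod_sumE (bigD1 b) //= big1 => [|b' bb].
  by rewrite !ffunE eqxx addr0 /GRing.scale /= mulr1.
by rewrite !ffunE (inj_eq (@bmap_inj _ _ _ e)) eq_sym (negbTE bb) scaler0.
Qed.

Lemma fpush_out m n (e : morph OI m n) f b' : (forall b, b' <> bmap e b) ->
  fpush e f b' = 0.
Proof.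
move=> h; rewrite /fpush fmod_sumE big1 // => b _.
by rewrite !ffunE; case: eqP => [/h//|_]; rewrite scaler0.
Qed.

Lemma fpushD m n (e : morph OI m n) f g : fpush e (f + g) = fpush e f + fpush e g.
Proof.
by rewrite /fpush -big_split; apply: eq_bigr => b _; rewrite ffunE pushD scalerDl.
Qed.

Lemma fpushZ m n (e : morph OI m n) (a : {mpoly K[c * m]}) f :
  fpush e (a *: f) = (push e a : {mpoly K[c * n]}) *: fpush e f.
Proof.
rewrite /fpush scaler_sumr; apply: eq_bigr => b _.
by rewrite ffunE scalerA -pushM.
Qed.

Lemma fpush0 m n (e : morph OI m n) : fpush e 0 = 0.
Proof. by rewrite -(scale0r (0 : fmod m)) fpushZ push0 scale0r. Qed.

Lemma fpush_sum m n (e : morph OI m n) (I : Type) (s : seq I) (P : pred I) (F : I -> fmod m) :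
  fpush e (\sum_(i <- s | P i) F i) = \sum_(i <- s | P i) fpush e (F i).
Proof. by apply: big_morph; [apply: fpushD | apply: fpush0]. Qed.

Lemma fpush_delta m n (e : morph OI m n) b : fpush e (fdelta b) = fdelta (bmap e b).
Proof.
rewrite /fpush (bigD1 b) //= big1 => [|b' /negbTE bb].
  by rewrite ffunE eqxx push1 scale1r addr0.
by rewrite ffunE bb push0 scale0r.
Qed.

Lemma fpush_id n f : fpush (morph_id OI n) f = f.
Proof.
by rewrite [RHS]fmod_decomp; apply: eq_bigr => b _; rewrite push_id bmap_id.
Qed.

Lemma fpush_comp m n p (g : morph OI n p) (f : morph OI m n) q :
  fpush (morph_comp g f) q = fpush g (fpush f q).
Proof.
rewrite [fpush f q]/fpush fpush_sum; apply: eq_bigr => b _.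
by rewrite fpushZ fpush_delta push_comp bmap_comp.
Qed.

Lemma fpush_part m n (e : morph OI m n) d f : fpart d f -> fpart d (fpush e f).
Proof.
move=> hf b' u; have [[b ->]|nb] := pselect (exists b, b' = bmap e b).
  rewrite fpush_bmap => /push_supp[v -> hv].
  by rewrite mdeg_pushm -[bdeg _]/(bdeg b); apply: hf.
by rewrite fpush_out ?mcoeff0 ?eqxx // => b e'; apply: nb; exists b.
Qed.

Definition free_imodule : graded_imodule OI K c :=
  @GradedIModule OI K c free_gmod fpush fpushD fpushZ fpush_id fpush_comp fpush_part.

End Free.

(** * Morphisms out of a free OI-module *)

Section FreeExt.
Variables (K : fieldType) (c : nat) (D : oi_gens) (X : graded_imodule OI K c).
Variable v : forall k : gen_idx D, X (gen_width k).

(** The basis element [(k, p)] is the push along [p] of generator [k], so naturality forces its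
    image to be the push of [v k]. *)
Definition free_ext n (f : free_gmod K c D n) : X n :=
  \sum_b (f : fmod K c D n) b *: imap (tagged b) (v (tag b)).

Lemma free_ext_linear n : linear (@free_ext n).
Proof.
move=> a f g; rewrite /free_ext scaler_sumr -big_split; apply: eq_bigr => b _ /=.
by rewrite !ffunE scalerDl scalerA.
Qed.

HB.instance Definition _ n := GRing.isLinear.Build {mpoly K[c * n]}
  (free_gmod K c D n) (X n) _ (@free_ext n) (@free_ext_linear n).

Lemma imap0 m n (e : morph OI m n) : imap e (0 : X m) = 0.
Proof. by rewrite -(scale0r (0 : X m)) imapZ push0 scale0r. Qed.

Lemma imap_sum m n (e : morph OI m n) (I : Type) (s : seq I) (P : pred I) (F : I -> X m) :
  imap e (\sum_(i <- s | P i) F i) = \sum_(i <- s | P i) imap e (F i).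
Proof. by apply: big_morph; [apply: imapD | apply: imap0]. Qed.

Lemma free_ext_delta n b : free_ext (fdelta K c b : free_gmod K c D n) =
  imap (tagged b) (v (tag b)).
Proof.
rewrite /free_ext (bigD1 b) //= big1 => [|b' /negbTE bb].
  by rewrite ffunE eqxx scale1r addr0.
by rewrite ffunE bb scale0r.
Qed.

Lemma free_extZ n (a : {mpoly K[c * n]}) (f : fmod K c D n) :
  free_ext (a *: f : fmod K c D n) = a *: free_ext f.
Proof. by rewrite /free_ext scaler_sumr; apply: eq_bigr => b _; rewrite ffunE scalerA. Qed.

Lemma free_ext_sum n (I : Type) (s : seq I) (P : pred I) (F : I -> fmod K c D n) :
  free_ext (\sum_(i <- s | P i) F i : fmod K c D n) = \sum_(i <- s | P i) free_ext (F i).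
Proof. exact: (raddf_sum (@free_ext n)). Qed.

Lemma free_ext_push m n (e : morph OI m n) (f : free_gmod K c D m) :
  free_ext (fpush e f : free_gmod K c D n) = imap e (free_ext f).
Proof.
rewrite [free_ext f]/free_ext imap_sum /fpush free_ext_sum; apply: eq_bigr => b _.
by rewrite free_extZ free_ext_delta imapZ -imap_comp.
Qed.

Lemma free_ext_homog n : (forall k, gpart (gen_deg k) (v k)) ->
  homogeneous_map (@free_ext n).
Proof.
move=> hv d f hf; rewrite /free_ext; apply: (big_ind (gpart d)).
- exact: (gr0 (gpartP (X n))).
- by move=> x y; apply: (grD (gpartP (X n))).
move=> b _; set a : {mpoly K[c * n]} := (f : fmod K c D n) b.
have [->|] := eqVneq a 0; first by rewrite scale0r; apply: (gr0 (gpartP (X n))).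
rewrite -msupp_eq0; case e: (msupp a) => [//|u r] _.
(* A monomial of the support exhibits the degree of the coefficient as a natural number, the form
   required by [grZ]. *)
have hu : a@_u != 0 by rewrite -mcoeff_msupp e mem_head.
rewrite -(hf _ _ hu); apply: (grZ (gpartP (X n))); last exact/imap_homog/hv.
apply/dhomogP => w; rewrite mcoeff_msupp => /hf hw.
by move: hw; rewrite -(hf _ _ hu) => /addIr [].
Qed.

End FreeExt.

(** * Noetherianity *)

Section Noetherian.
Variables (K : fieldType) (c : nat) (D : oi_gens).

Definition fcoef n (t : term c D n) (f : fmod K c D n) : K :=
  (f t.1 : {mpoly K[c * n]})@_t.2.

Lemma fcoefD n (t : term c D n) : {morph fcoef t : x y / x + y}.
Proof. by move=> x y; rewrite /fcoef ffunE mcoeffD. Qed.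

Lemma fcoefZ n (t : term c D n) a x : fcoef t (a%:MP *: x) = a * fcoef t x.
Proof. by rewrite /fcoef ffunE mcoeffCM. Qed.

Lemma fcoef_eq0 n (x : fmod K c D n) : (forall t, fcoef t x = 0) -> x = 0.
Proof. by move=> h; apply: fmodP => b u; rewrite ffunE mcoeff0 -(h (b, u)). Qed.

Lemma fcoef_supp n (x : fmod K c D n) :
  exists L : seq (term c D n), forall t, fcoef t x != 0 -> t \in L.
Proof.
exists [seq (b, u) | b <- enum {: basis D n}, u <- msupp (x b : {mpoly K[c * n]})].
move=> [b u] /= h; apply/allpairsPdep; exists b, u.
by rewrite mem_enum mcoeff_msupp.
Qed.

Definition is_lterm n (x : fmod K c D n) t :=
  is_lead (@term_lt c D n) (@fcoef n) x t.

(** The coefficients are moved unchanged along [act e w], which preserves the order by [act_lt]. *)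
Lemma is_lterm_act m n (e : morph OI m n) w (x : fmod K c D m) t : is_lterm x t ->
  is_lterm (('X_[w] : {mpoly K[c * n]}) *: fpush e x) (act e w t).
Proof.
have coefX (p : {mpoly K[c * n]}) u : ('X_[w] * p)@_(w + u)%MM = p@_u.
  by rewrite mulrC mcoeffMX.
move=> [tx hx]; split.
  by rewrite /fcoef /act /= ffunE coefX fpush_bmap push_mcoeff.
move=> [b' u']; rewrite {1}/fcoef /= ffunE => /mcoeffM_neq0[w' [u1 [-> ]]].
rewrite mcoeffX; case: (w =P w') => [<- _|]; last by rewrite eqxx.
have [[b ->]|nb] := pselect (exists b, b' = bmap e b); last first.
  by rewrite fpush_out ?mcoeff0 ?eqxx // => b eb; apply: nb; exists b.
rewrite fpush_bmap => /push_supp[u -> hu] ne.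
rewrite -[(_, _)]/(act e w (b, u)); apply/act_lt/hx => //.
by apply: contraNneq ne => <-.
Qed.

Lemma noetherian (Q : forall n, free_imodule K c D n -> Prop) : is_submodule Q ->
  (forall n q, Q n q -> exists (s : seq int) (y : int -> free_imodule K c D n),
     [/\ forall d, gpart d (y d), forall d, Q n (y d) & q = \sum_(d <- s) y d]) ->
  exists (D' : oi_gens) (v : forall k : gen_idx D', free_imodule K c D (gen_width k)),
    [/\ forall k, gpart (gen_deg k) (v k), forall k, Q _ (v k) &
      forall n q, Q n q -> exists f, free_ext v f = q :> free_imodule K c D n].
Proof.
move=> subQ grQ.
(* Only homogeneous elements contribute leading terms: the generators must be homogeneous, and the
   division below stays in one degree. *)
pose E (t : {n & term c D n}) := exists (d : int) (q : free_imodule K c D (tag t)),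
  [/\ Q _ q, gpart d q & is_lterm q (tagged t)].
pose r (s t : {n & term c D n}) := exists e w, tagged t = act e w (tagged s).
have [s _|k [b [Eb bE]]] := @finite_basis _ r E; first exact: term_wqo.
have /fin_all_exists[d hd] := Eb.
have /fin_all_exists[q hq] := hd.
exists (@OIGens 'I_k (fun i => tag (b i)) d), q; split=> [i|i|n x Qx].
- by case: (hq i).
- by case: (hq i).
pose V x := exists f, @free_ext K c (@OIGens 'I_k (fun i => tag (b i)) d)
  (free_imodule K c D) q n f = x.
have V0 : V 0 by exists 0; apply: raddf0.
have VD z y (a : {mpoly K[c * n]}) : V z -> V y -> V (z + a *: y).
  move=> [f <-] [g <-]; exists (a *: g + f); rewrite free_ext_linear; exact: addrC.
have {x Qx} [l [y [hy Qy ->]]] := grQ _ _ Qx.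
suff {l} Vy e : V (y e).
  elim: l => [|e l [f hf]]; first by rewrite big_nil.
  rewrite big_cons; have [g hg] := Vy e; exists (g + f).
  by rewrite -hg -hf; apply: (raddfD (@free_ext _ _ _ _ _ _)).
(* In degree [e] a monomial at [b0] has degree [e - bdeg b0], at most [N]; hence [L] contains all
   terms that can occur. *)
pose N := (\max_(b0 : basis D n) `|e - bdeg b0|)%N.
pose L := [seq (b0, val u) | b0 <- enum {: basis D n}, u <- enum {: 'X_{1..(c * n) < N.+1}}].
apply: (@lead_division K (c * n) (fmod K c D n) _ (@term_lt c D n) (@fcoef n)
  (@term_lt_irr c D n) (@term_lt_trans c D n) (@term_lt_total c D n)
  (@fcoefD n) (@fcoefZ n) (@fcoef_eq0 n) (@fcoef_supp n) L
  (fun x : free_imodule K c D n => Q n x /\ gpart e x) V) => //.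
- move=> x [b0 u] [_ hx] /hx he.
  have uN : (mdeg u < N.+1)%N.
    rewrite ltnS; apply: leq_trans (leq_bigmax b0); rewrite /= -he addrK; exact: leqnn.
  apply/allpairsP; exists (b0, Sub u uN); split=> //=; first by rewrite mem_enum.
  by rewrite mem_enum.
- move=> x z a [Qx ex] [Qz ez]; split.
    by apply: (subD subQ) => //; apply: (subZ subQ).
  apply: (grD (gpartP _)) => //; rewrite -[e]add0r; apply: (grZ (gpartP _)) => //.
  by apply/dhomogP => w; rewrite msuppC; case: eqP => // _;
    rewrite inE => /eqP ->; apply: mdeg0.
- by move=> x z a; apply: VD.
- move=> x t [Qx ex] lx.
  have [i [g [w hw]]] := bE (existT _ n t) (ex_intro _ e (ex_intro _ x (And3 Qx ex lx))).
  have [Qi ei li] := hq i; rewrite /= in g w hw.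
  pose z : fmod K c D n := ('X_[w] : {mpoly K[c * n]}) *: fpush g (q i).
  have lz : is_lterm z t by rewrite hw; apply: is_lterm_act.
  have Qz : Q n z by apply: (subZ subQ); apply: (sub_map subQ).
  exists z; split=> //.
  + split=> //.
    have ez : gpart ((mdeg w)%:Z + d i) (z : free_gmod K c D n).
      apply: (grZ (gpartP (free_gmod K c D n))); first by rewrite dhomogX.
      exact: fpush_part.
    (* Both [x] and [z] are homogeneous and have the term [t], so their degrees agree. *)
    have -> // : e = (mdeg w)%:Z + d i.
    have [nz _] := lz; rewrite -(ez _ _ nz).
    by have [nx _] := lx; rewrite (ex _ _ nx).
  + pose b1 : basis (@OIGens 'I_k (fun i => tag (b i)) d) n :=
      existT (fun j => morph OI (tag (b j)) n) i g.
    exists (('X_[w] : {mpoly K[c * n]}) *: fdelta K c b1).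
    by rewrite free_extZ free_ext_delta.
Qed.

End Noetherian.

(** * Independence of Tor from the resolution *)

Section GradedLift.
Variables (K : fieldType) (N : nat).
Local Notation S := {mpoly K[N]}.
Local Notation gmod := (gradedModule K N).

(** [gr_sum] may list a degree repeatedly; collecting repetitions makes [gr_direct] applicable. *)
Lemma gr_sum_uniq (M : gmod) (x : M) : exists (s : seq int) (y : int -> M),
  [/\ uniq s, forall d, gpart d (y d) & x = \sum_(d <- s) y d].
Proof.
have [s [y [hy ->]]] := gr_sum (gpartP M) x.
have [|t [z [ut hz e]]] := TensoredResolution.sum_by_degree (gr0 (gpartP M))
   (@grD _ _ _ _ (gpartP M)) (l := [seq (d, y d) | d <- s]).
  by move=> _ /mapP[d _ ->]; apply: hy.
by exists t, z; split=> //; rewrite -e big_map.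
Qed.

Lemma gpartC (M : gmod) d a (x : M) : gpart d x -> gpart d (a%:MP *: x).
Proof.
move=> h; rewrite -[d]add0r; apply: (grZ (gpartP M)) => //.
by apply/dhomogP => w; rewrite msuppC; case: eqP => // _; rewrite inE => /eqP ->; apply: mdeg0.
Qed.

Lemma gpartN (M : gmod) d (x : M) : gpart d x -> gpart d (- x).
Proof. by move=> /(gpartC (-1)); rewrite mpolyCN mpolyC1 scaleN1r. Qed.

Lemma homogeneous_component (M : gmod) d (x : M) (s : seq int) (y : int -> M) :
  uniq s -> (forall e, gpart e (y e)) -> gpart d x -> x = \sum_(e <- s) y e ->
  x = if d \in s then y d else 0.
Proof.
move=> us hy hx ex.
(* The difference of the two decompositions of [x], both extended by zero to the common list [t];
   its components vanish by directness. *)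
pose z e := (if e \in s then y e else 0) - (if e == d then x else 0).
have hz e : gpart e (z e).
  apply: (grD (gpartP M)).
    by case: ifP => // _; apply: (gr0 (gpartP M)).
  by apply: gpartN; case: eqP => [->//|_]; apply: (gr0 (gpartP M)).
pose t := undup (d :: s).
have dt : d \in t by rewrite mem_undup mem_head.
have /(gr_direct (gpartP M) (undup_uniq _) hz) : \sum_(e <- t) z e = 0.
  rewrite sumrB [X in _ - X](bigD1_seq d) ?undup_uniq //= eqxx.
  rewrite [X in _ - (_ + X)]big1 => [|e /negbTE -> //].
  rewrite addr0 -big_mkcond -big_filter; apply/eqP; rewrite subr_eq0 ex; apply/eqP.
  apply: perm_big; apply: uniq_perm; rewrite ?filter_uniq ?undup_uniq //.
  move=> e; rewrite mem_filter mem_undup inE; case: (e \in s) => //=.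
  by rewrite orbT.
by move=> /(_ _ dt) /eqP; rewrite /z eqxx subr_eq0 => /eqP.
Qed.

Section Extension.
Variables (F A : gmod) (B : F -> Prop) (w : F -> A).
Hypothesis Bb : is_homogeneous_basis B.

(** A basis provides coefficients only existentially, so the linear extension is first a relation,
    shown linear and single-valued. Repetitions in [l] are allowed, which makes addition a
    concatenation. *)
Let graph x y := exists l : seq (S * F), [/\ forall u, u \in l -> B u.2,
  x = \sum_(u <- l) u.1 *: u.2 & y = \sum_(u <- l) u.1 *: w u.2].

(** Collects the coefficients of repeated elements, so that [basis_free] applies. *)
Local Lemma regroup (V : lmodType S) (g : F -> V) (l : seq (S * F)) :
  \sum_(u <- l) u.1 *: g u.2 =
  \sum_(b <- undup (map snd l)) (\sum_(u <- l | u.2 == b) u.1) *: g b.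
Proof.
under [RHS]eq_bigr do rewrite scaler_suml.
rewrite [RHS](exchange_big_dep xpredT) //= big_seq [RHS]big_seq.
apply: eq_bigr => u ul.
rewrite -big_filter (@eq_filter _ _ (pred1 u.2)); last by move=> b /=; rewrite eq_sym.
by rewrite filter_pred1_uniq ?undup_uniq ?big_seq1 // mem_undup; apply: map_f.
Qed.

Local Lemma graph0 y : graph 0 y -> y = 0.
Proof.
move=> [l [hl x0 ->]]; rewrite regroup big_seq big1 // => b bl.
rewrite (_ : \sum_(u <- l | u.2 == b) u.1 = 0) ?scale0r //.
apply: (basis_free Bb (undup_uniq (map snd l))
  (a := fun b => \sum_(u <- l | u.2 == b) u.1)) => //.
  by move=> b'; rewrite mem_undup => /mapP[u ul ->]; apply: hl.
by rewrite -(regroup id).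
Qed.

Local Lemma graphP c x y x' y' : graph x y -> graph x' y' ->
  graph (c *: x + x') (c *: y + y').
Proof.
move=> [l [hl -> ->]] [l' [hl' -> ->]].
exists ([seq (c * u.1, u.2) | u <- l] ++ l'); split.
- by move=> u; rewrite mem_cat => /orP[/mapP[v vl ->]|]; [apply: (hl v) | apply: hl'].
- rewrite big_cat big_map scaler_sumr; congr (_ + _).
  by apply: eq_bigr => u _; rewrite scalerA.
- rewrite big_cat big_map scaler_sumr; congr (_ + _).
  by apply: eq_bigr => u _; rewrite scalerA.
Qed.

Lemma basis_extension : exists g : {linear F -> A}, forall b, B b -> g b = w b.
Proof.
have /choice[g hg] : forall x, exists y, graph x y.
  move=> x; have [s [a [hs ->]]] := basis_span Bb x.
  exists (\sum_(b <- s) a b *: w b), [seq (a b, b) | b <- s]; rewrite !big_map.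
  by split=> // u /mapP[b bs ->]; apply: hs.
have guniq x y : graph x y -> y = g x.
  move=> h; have := graphP (-1) (hg x) h; rewrite !scaleN1r addNr.
  by move/graph0/eqP; rewrite addrC subr_eq0 => /eqP.
have glin : linear g by move=> c x y; apply/esym/guniq/graphP.
pose gl := GRing.isLinear.Build S F A _ g glin.
exists (HB.pack_for {linear F -> A} g gl) => b Bb'.
apply/esym/guniq; exists [:: (1, b)]; rewrite !big_seq1 !scale1r; split=> // u.
by rewrite inE => /eqP ->.
Qed.

(** Every element is a sum of elements that are homogeneous together with their images, in the same
    degree. If the element is itself homogeneous, only the component of its degree survives. *)
Lemma homogeneous_on_basis (g : {linear F -> A}) :
  (forall b d, B b -> gpart d b -> gpart d (g b)) -> homogeneous_map g.
Proof.
move=> hgB.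
pose gr d x := gpart d x /\ gpart d (g x).
pose P x := exists l : seq (int * F), (forall u, u \in l -> gr u.1 u.2) /\
  x = \sum_(u <- l) u.2.
have PD x y : P x -> P y -> P (x + y).
  move=> [l [hl ->]] [l' [hl' ->]]; exists (l ++ l'); rewrite big_cat; split=> // u.
  by rewrite mem_cat => /orP[/hl|/hl'].
have P0 : P 0 by exists [::]; rewrite big_nil.
have PZ a b : B b -> P (a *: b).
  move=> hb; have [d hd] := basis_homog Bb hb.
  exists [seq ((mdeg m)%:Z + d, (a@_m *: 'X_[m]) *: b) | m <- msupp a]; split.
    move=> _ /mapP[m _ ->] /=.
    have hX : a@_m *: 'X_[m] \is (mdeg m).-homog by rewrite rpredZ // dhomogX.
    split; first exact: (grZ (gpartP F)).
    by rewrite linearZ; apply: (grZ (gpartP A)) => //; apply: hgB.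
  by rewrite big_map -scaler_suml -mpolyE.
have Px x : P x.
  have [s [a [hs ->]]] := basis_span Bb x; rewrite big_seq.
  by apply: (big_ind P) => // b /hs; apply: PZ.
move=> d x hx; have [l [hl ex]] := Px x.
have [||s [y [us hy e]]] := @TensoredResolution.sum_by_degree K N F gr _ _ l hl.
- by move=> e; split; rewrite ?raddf0; apply: gr0; apply: gpartP.
- move=> e y z [hy hy'] [hz hz']; split; rewrite ?raddfD; apply: grD => //; exact: gpartP.
rewrite (@homogeneous_component F d x s y us (fun e => (hy e).1) hx) -?e -?ex //.
by case: ifP => _; [case: (hy d) | rewrite raddf0; apply: gr0; apply: gpartP].
Qed.

End Extension.

(** Projectivity of graded free modules. A basis element of degree [d] is sent to the degree [d]
    component of any preimage, which is again a preimage because [p] is homogeneous. *)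
Lemma free_lift (F A A' : gmod) (f : {linear F -> A'}) (p : {linear A -> A'}) :
  graded_free F -> homogeneous_map f -> homogeneous_map p ->
  (forall x, exists y, f x = p y) ->
  exists2 g : {linear F -> A}, homogeneous_map g & forall x, p (g x) = f x.
Proof.
move=> [B Bb] hf hp im.
have /choice[w hw] : forall b, exists y, p y = f b /\ forall d, B b -> gpart d b -> gpart d y.
  move=> b; have [[d hd]|nd] := pselect (exists d, B b /\ gpart d b); last first.
    have [y hy] := im b; exists y; split=> // d Bb' hd; by case: nd; exists d.
  have [y fy] := im b; have [s [z [us hz ez]]] := gr_sum_uniq y.
  exists (if d \in s then z d else 0); split.
    have hpz e : gpart e (p (z e)) by apply: hp.
    rewrite [RHS](@homogeneous_component A' d (f b) s (fun e => p (z e)) us hpz).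
    - by case: ifP => // _; apply: raddf0.
    - by apply: hf; case: hd.
    - by rewrite fy ez raddf_sum.
  move=> e _ he; have [Bb' hd'] := hd.
  (* An element of a basis is nonzero by freeness, so it has only one degree. *)
  have -> : e = d.
    apply: contrapT => /eqP ed.
    have b0 : b = 0.
      have := @homogeneous_component F d b [:: e] (fun e' => if e' == e then b else 0).
      rewrite inE eq_sym (negbTE ed) big_seq1 eqxx; apply=> // e'.
      by case: eqP => [->|_] //; apply: gr0; apply: gpartP.
    have /eqP := basis_free Bb (s := [:: b]) (a := fun=> 1) isT
      (fun x => ltac:(rewrite inE => /eqP -> //))
      (ltac:(by rewrite big_seq1 b0 scaler0)) (mem_head _ _).
    by rewrite oner_eq0.
  by case: ifP => // _; apply: gr0; apply: gpartP.
have [g hg] := basis_extension w Bb.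
exists g.
  by apply: (homogeneous_on_basis Bb) => b d Bb' hd; rewrite hg //; apply: (hw b).2.
move=> x; have [s [a [hs ->]]] := basis_span Bb x.
rewrite !raddf_sum big_seq [RHS]big_seq; apply: eq_bigr => b /hs Bb'.
by rewrite /= !linearZ /= hg // (hw b).1.
Qed.

End GradedLift.

(** Chain maps and homotopies are built degree by degree: [P] is what makes the next lift possible,
    [R] the equation linking consecutive maps. *)
Lemma dependent_choice (T : nat -> Type) (P : forall k, T k -> Prop)
    (R : forall k, T k -> T k.+1 -> Prop) (x0 : T 0%N) : P 0%N x0 ->
  (forall k x, P k x -> exists2 y, P k.+1 y & R k x y) ->
  exists f : forall k, T k, [/\ f 0%N = x0, forall k, P k (f k)
    & forall k, R k (f k) (f k.+1)].
Proof.
move=> P0 step.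
have st k (x : {x : T k | P k x}) : {y : {y : T k.+1 | P k.+1 y} | R k (sval x) (sval y)}.
  by apply: cid; have [y Py Ry] := step k _ (svalP x); exists (exist _ y Py).
pose f := nat_rect (fun k => {x : T k | P k x}) (exist _ x0 P0) (fun k x => sval (st k x)).
exists (fun k => sval (f k)); split=> // k; first exact: svalP.
exact: (svalP (st k (f k))).
Qed.

Lemma choice_dep (I : Type) (T : I -> Type) (P : forall i, T i -> Prop) :
  (forall i, exists x, P i x) -> exists f : forall i, T i, forall i, P i (f i).
Proof. by move=> h; exists (fun i => sval (cid (h i))) => i; apply: svalP. Qed.

(** * Chain maps and homotopies between graded free resolutions *)

Section Compare.
Variables (K : fieldType) (N : nat).
Local Notation S := {mpoly K[N]}.
Local Notation gmod := (gradedModule K N).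
Variable M : gmod.

Lemma res_diff_aug (F : graded_free_resolution M) x : res_aug F (res_diff F 0 x) = 0.
Proof. by apply/res_exact0; exists x. Qed.

Lemma res_diffK (F : graded_free_resolution M) k x :
  res_diff F k (res_diff F k.+1 x) = 0.
Proof. by apply/res_exactS; exists x. Qed.

Definition chain_map (F G : graded_free_resolution M) (f : forall k, {linear F k -> G k}) :=
  [/\ forall k, homogeneous_map (f k), forall x, res_aug G (f 0%N x) = res_aug F x
    & forall k x, res_diff G k (f k.+1 x) = f k (res_diff F k x)].

Lemma chain_map_exists (F G : graded_free_resolution M) :
  exists f, @chain_map F G f.
Proof.
(* The second clause is the hypothesis on images that [free_lift] asks for in the next degree. *)
pose P k (f : {linear F k -> G k}) :=
  homogeneous_map f /\ forall x, exists y, f (res_diff F k x) = res_diff G k y.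
have [f0 hf0 ef0] : exists2 f : {linear F 0%N -> G 0%N},
    homogeneous_map f & forall x, res_aug G (f x) = res_aug F x.
  apply: free_lift; [exact: res_free | exact: res_aug_homog | exact: res_aug_homog |].
  by move=> x; have [y] := res_aug_surj G (res_aug F x); exists y.
have P0 : P 0%N f0.
  by split=> // x; apply/res_exact0; rewrite ef0 res_diff_aug.
have [|f [f0E Pf Rf]] := @dependent_choice (fun k => {linear F k -> G k}) P
    (fun k f g => forall x, res_diff G k (g x) = f (res_diff F k x)) f0 P0.
  move=> k f [hf imf].
  have [||||g hg eg] := @free_lift K N (F k.+1) (G k.+1) (G k)
      (f \o res_diff F k)%FUN (res_diff G k).
  - exact: res_free.
  - by move=> d x hx; apply/hf/res_diff_homog.
  - exact: res_diff_homog.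
  - exact: imf.
  exists g => //; split=> // x; apply/res_exactS.
  by rewrite eg /= res_diffK raddf0.
by exists f; split=> [k||//]; [case: (Pf k) | rewrite f0E].
Qed.

Lemma homotopy_exists (F G : graded_free_resolution M) f g :
  @chain_map F G f -> @chain_map F G g ->
  exists h : forall k, {linear F k -> G k.+1},
    [/\ forall k, homogeneous_map (h k),
      forall x, f 0%N x - g 0%N x = res_diff G 0 (h 0%N x)
      & forall k x, f k.+1 x - g k.+1 x =
          res_diff G k.+1 (h k.+1 x) + h k (res_diff F k x)].
Proof.
move=> [hf af df] [hg ag dg].
have hB (A B : gmod) (u v : {linear A -> B}) :
    homogeneous_map u -> homogeneous_map v -> homogeneous_map (u \- v).
  by move=> hu hv d x hx /=; apply: (grD (gpartP _)); [apply: hu | apply/gpartN/hv].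
(* The equation says that the next map to be lifted, [f - g - h d], takes values in the kernel of
   the differential of [G], hence in an image. *)
pose P k (h : {linear F k -> G k.+1}) := homogeneous_map h /\
  forall y, res_diff G k (h (res_diff F k y)) = f k (res_diff F k y) - g k (res_diff F k y).
have [h0 hh0 eh0] : exists2 h : {linear F 0%N -> G 1%N},
    homogeneous_map h & forall x, res_diff G 0 (h x) = (f 0%N \- g 0%N) x.
  apply: free_lift; [exact: res_free | exact: hB | exact: res_diff_homog |].
  by move=> x; apply/res_exact0; rewrite /= raddfB /= af ag subrr.
have P0 : P 0%N h0 by split=> // y; rewrite eh0.
have [|h [h0E Ph Rh]] := @dependent_choice (fun k => {linear F k -> G k.+1}) P
    (fun k h h' => forall x, f k.+1 x - g k.+1 x = res_diff G k.+1 (h' x) + h (res_diff F k x))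
    h0 P0.
  move=> k h [hh eh].
  pose u : {linear F k.+1 -> G k.+1} := ((f k.+1 \- g k.+1) \- (h \o res_diff F k))%FUN.
  have [||||h' hh' eh'] := @free_lift K N (F k.+1) (G k.+2) (G k.+1) u (res_diff G k.+1).
  - exact: res_free.
  - apply: (hB (F k.+1)); first exact: hB.
    by move=> d x hx; apply/hh/res_diff_homog.
  - exact: res_diff_homog.
  - by move=> x; apply/res_exactS; rewrite /u /= !raddfB /= df dg eh subrr.
  exists h'; last by move=> x; rewrite eh' /u /= subrK.
  by split=> // y; rewrite eh' /u /= res_diffK raddf0 subr0.
by exists h; split=> [k|x|//]; [case: (Ph k) | rewrite h0E eh0].
Qed.

(** * Functoriality of the tensored complexes *)

Section Tensor.
Variables (L : gmod) (F G : graded_free_resolution M).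
Variables (C : tensored_complex F L) (E : tensored_complex G L).

Definition comp_pure k (U V : lmodType S) (t : {bilinear U -> L -> V}) (f : {linear F k -> U})
  (x : F k) (a : L) : V := t (f x) a.

Fact comp_pure_bilinear k (U V : lmodType S) (t : {bilinear U -> L -> V})
    (f : {linear F k -> U}) :
  bilinear_for (GRing.Scale.Law.clone _ _ *:%R _)
    (GRing.Scale.Law.clone _ _ *:%R _) (comp_pure t f).
Proof.
split=> [a|x] s y z; rewrite /comp_pure; last exact: linearPr.
by rewrite linearP linearPl.
Qed.

HB.instance Definition _ k (U V : lmodType S) (t : {bilinear U -> L -> V})
  (f : {linear F k -> U}) :=
  bilinear_isBilinear.Build _ _ _ _ _ _ (comp_pure t f) (comp_pure_bilinear t f).

Lemma tens_map k k' (f : {linear F k -> G k'}) : exists g : {linear C k -> E k'},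
  forall x a, g (tens_pure C k x a) = tens_pure E k' (f x) a.
Proof.
have [g [hg _]] := @tens_univ _ _ _ _ _ C k _ (comp_pure (tens_pure E k') f).
by exists g.
Qed.

Definition post_pure k (V : lmodType S) (g : {linear C k -> V}) (x : F k) (a : L) : V :=
  g (tens_pure C k x a).

Fact post_pure_bilinear k (V : lmodType S) (g : {linear C k -> V}) :
  bilinear_for (GRing.Scale.Law.clone _ _ *:%R _)
    (GRing.Scale.Law.clone _ _ *:%R _) (post_pure g).
Proof.
split=> [a|x] s y z; rewrite /post_pure; first by rewrite linearPl linearP.
by rewrite linearPr linearP.
Qed.

HB.instance Definition _ k (V : lmodType S) (g : {linear C k -> V}) :=
  bilinear_isBilinear.Build _ _ _ _ _ _ (post_pure g) (post_pure_bilinear g).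

Lemma tens_ext k (V : lmodType S) (g g' : {linear C k -> V}) :
  (forall x a, g (tens_pure C k x a) = g' (tens_pure C k x a)) -> g =1 g'.
Proof.
move=> h; have [u [_ hu]] := @tens_univ _ _ _ _ _ C k _ (post_pure g).
move=> z; rewrite (hu g) //; apply/esym/hu => x a; exact/esym/h.
Qed.

Lemma tensor_homog_map k k' (f : {linear F k -> G k'}) (g : {linear C k -> E k'}) j z :
  homogeneous_map f -> (forall x a, g (tens_pure C k x a) = tens_pure E k' (f x) a) ->
  tensor_homog (tens_pure C k) j z -> tensor_homog (tens_pure E k') j (g z).
Proof.
move=> hf hg [s [hs ->]]; exists [seq (f u.1, u.2) | u <- s]; split.
  move=> _ /mapP[u us ->] /=; have [d [e [hd he <-]]] := hs u us.
  by exists d, e; split=> //; apply: hf.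
by rewrite raddf_sum big_map; apply: eq_bigr => u _ /=; rewrite hg.
Qed.

Lemma tens_chain f : @chain_map F G f -> exists g : forall k, {linear C k -> E k},
  (forall k x a, g k (tens_pure C k x a) = tens_pure E k (f k x) a) /\
  forall k z, tens_diff E k (g k.+1 z) = g k (tens_diff C k z).
Proof.
move=> [_ _ df]; have /choice_dep[g hg] := fun k => tens_map (f k).
exists g; split=> // k z.
apply: (tens_ext (g := (tens_diff E k \o g k.+1)%FUN) (g' := (g k \o tens_diff C k)%FUN)).
by move=> x a; rewrite /= hg !tens_diffE hg df.
Qed.

End Tensor.

(** A chain endomorphism over [M] is homotopic to the identity. After tensoring, the term of the
    homotopy containing the differential of [z] vanishes on cycles, and in degree 0 there is no such
    term. *)
Lemma tens_homotopic (L : gmod) (F : graded_free_resolution M) (C : tensored_complex F L)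
    (f : forall k, {linear F k -> F k}) (g : forall k, {linear C k -> C k}) i j z :
  chain_map f -> (forall k x a, g k (tens_pure C k x a) = tens_pure C k (f k x) a) ->
  tens_cycles j z -> tens_boundaries (C := C) (i := i) j (g i z - z).
Proof.
move=> hf hg [hz cz].
have idc : chain_map (fun k => idfun : {linear F k -> F k}) by split=> [k d x|x|k x].
have [h [hh h0 hS]] := homotopy_exists hf idc.
have /choice_dep[u hu] := fun k => tens_map C C (h k).
exists (u i z); first exact: tensor_homog_map (hh i) (hu i) hz.
case: i z hz cz => [|i] z hz cz.
  apply: (tens_ext (g := (g 0%N \- idfun)%FUN) (g' := (tens_diff C 0 \o u 0%N)%FUN)) => x a.
  by rewrite /= hg hu tens_diffE -h0 /= linearBl.
pose A : {linear C i.+1 -> C i.+1} := (g i.+1 \- idfun)%FUN.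
pose B : {linear C i.+1 -> C i.+1} :=
  ((tens_diff C i.+1 \o u i.+1) \+ (u i \o tens_diff C i))%FUN.
have AB : A z = B z.
  apply: tens_ext => x a; rewrite /A /B /= hg !hu !tens_diffE hu -linearDl -hS /=.
  by rewrite linearBl.
by move: AB; rewrite /A /B /= cz raddf0 addr0.
Qed.

Lemma tensor_homogD (A B : gmod) (T : lmodType S) (t : {bilinear A -> B -> T}) j x y a :
  tensor_homog t j x -> tensor_homog t j y -> tensor_homog t j (x + a%:MP *: y).
Proof.
move=> [s [hs ->]] [s' [hs' ->]].
exists (s ++ [seq (a%:MP *: u.1, u.2) | u <- s']); split=> [u|].
  rewrite mem_cat => /orP[/hs//|/mapP[v /hs'[d [e [hd he <-]]] ->]].
  by exists d, e; split=> //; apply: gpartC.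
rewrite big_cat scaler_sumr big_map; congr (_ + _).
by apply: eq_bigr => u _; rewrite /= (linearZl_LR t).
Qed.

Lemma tens_boundariesP (L : gmod) (F : graded_free_resolution M) (C : tensored_complex F L)
    i j x y a : tens_boundaries (C := C) (i := i) j x -> tens_boundaries j y ->
  tens_boundaries (C := C) (i := i) j (x + a%:MP *: y).
Proof.
move=> [w hw ->] [w' hw' ->]; exists (w + a%:MP *: w'); first exact: tensor_homogD.
by rewrite raddfD /= linearZ.
Qed.

Lemma tens_boundaries0 (L : gmod) (F : graded_free_resolution M) (C : tensored_complex F L)
    i j :
  tens_boundaries (C := C) (i := i) j 0.
Proof. by exists 0; [exists [::]; rewrite big_nil | rewrite raddf0]. Qed.

Lemma tens_boundaries_sum (L : gmod) (F : graded_free_resolution M) (C : tensored_complex F L)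
    i j (I : Type) (s : seq I) (a : I -> K) y : (forall k, tens_boundaries j (y k)) ->
  tens_boundaries (C := C) (i := i) j (\sum_(k <- s) (a k)%:MP *: y k).
Proof.
move=> hy; elim: s => [|k s IH]; first by rewrite big_nil; apply: tens_boundaries0.
by rewrite big_cons addrC; apply: tens_boundariesP.
Qed.

Lemma tens_cycles0 (L : gmod) (F : graded_free_resolution M) (C : tensored_complex F L) i j :
  tens_cycles (C := C) (i := i) j 0.
Proof. by split; [exists [::]; rewrite big_nil | case: i => //= i; rewrite raddf0]. Qed.

Lemma tens_cyclesP (L : gmod) (F : graded_free_resolution M) (C : tensored_complex F L)
    i j x y a : tens_cycles (C := C) (i := i) j x -> tens_cycles j y ->
  tens_cycles (C := C) (i := i) j (x + a%:MP *: y).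
Proof.
move=> [hx cx] [hy cy]; split; first exact: tensor_homogD.
case: i x y {hx hy} cx cy => //= i x y cx cy.
by rewrite raddfD /= linearZ /= cx cy scaler0 addr0.
Qed.

Lemma tens_boundaries_cycles (L : gmod) (F : graded_free_resolution M)
    (C : tensored_complex F L) i j x :
  tens_boundaries (C := C) (i := i) j x -> tens_cycles (C := C) (i := i) j x.
Proof.
move=> [w hw ->]; split.
  case: hw => s [hs ->]; exists [seq (res_diff F i u.1, u.2) | u <- s]; split.
    move=> _ /mapP[u /hs[d [e [hd he <-]]] ->]; exists d, e; split=> //.
    exact: res_diff_homog.
  by rewrite raddf_sum big_map; apply: eq_bigr => u _; rewrite /= tens_diffE.
case: i x w {hw} => //= i _ w.
apply: (tens_ext (g := (tens_diff C i \o tens_diff C i.+1)%FUN) (g' := \0%FUN)) => y a.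
by rewrite /= !tens_diffE res_diffK linear0l.
Qed.

Lemma tens_boundaries_map (L : gmod) (F G : graded_free_resolution M)
    (C : tensored_complex F L) (E : tensored_complex G L)
    f (g : forall k, {linear C k -> E k}) i j z :
  @chain_map F G f -> (forall k x a, g k (tens_pure C k x a) = tens_pure E k (f k x) a) ->
  (forall k z, tens_diff E k (g k.+1 z) = g k (tens_diff C k z)) ->
  tens_boundaries (C := C) (i := i) j z -> tens_boundaries (C := E) (i := i) j (g i z).
Proof.
move=> [hf _ _] hg dg [w hw ->]; exists (g i.+1 w); last by rewrite dg.
exact: tensor_homog_map (hf _) (hg _) hw.
Qed.

Lemma tens_cycles_map (L : gmod) (F G : graded_free_resolution M)
    (C : tensored_complex F L) (E : tensored_complex G L)
    f (g : forall k, {linear C k -> E k}) i j z :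
  @chain_map F G f -> (forall k x a, g k (tens_pure C k x a) = tens_pure E k (f k x) a) ->
  (forall k z, tens_diff E k (g k.+1 z) = g k (tens_diff C k z)) ->
  tens_cycles (C := C) (i := i) j z -> tens_cycles (C := E) (i := i) j (g i z).
Proof.
move=> [hf _ _] hg dg [hz cz]; split; first exact: tensor_homog_map (hf _) (hg _) hz.
by case: i z {hz} cz => [//|i] z /= cz; rewrite dg cz raddf0.
Qed.

Lemma chain_map_comp (F G H : graded_free_resolution M) f g :
  @chain_map F G f -> @chain_map G H g -> chain_map (fun k => (g k \o f k)%FUN).
Proof.
move=> [hf af df] [hg ag dg]; split=> [k d x hx|x|k x] /=.
- exact/hg/hf.
- by rewrite ag af.
- by rewrite dg df.
Qed.

(** The comparison maps [u] and [v] are inverse to each other up to boundaries, so [u] carries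
    representatives of a basis to representatives of a basis. *)
Lemma subquotient_dim_indep (L : gmod) (F G : graded_free_resolution M)
    (C : tensored_complex F L) (E : tensored_complex G L) i j b :
  has_subquotient_dim (@tens_cycles K N M L F C i j) (@tens_boundaries K N M L F C i j) b ->
  has_subquotient_dim (@tens_cycles K N M L G E i j) (@tens_boundaries K N M L G E i j) b.
Proof.
have [f hf] := chain_map_exists F G; have [g hg] := chain_map_exists G F.
have [u [hu du]] := tens_chain C E hf; have [v [hv dv]] := tens_chain E C hg.
have vu z : tens_cycles j z -> tens_boundaries (C := C) (i := i) j (v i (u i z) - z).
  move=> hz; apply: (tens_homotopic (g := fun k => (v k \o u k)%FUN)
    (chain_map_comp hf hg)) => //.
  by move=> k x a /=; rewrite hu hv.
have uv z : tens_cycles j z -> tens_boundaries (C := E) (i := i) j (u i (v i z) - z).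
  move=> hz; apply: (tens_homotopic (g := fun k => (u k \o v k)%FUN)
    (chain_map_comp hg hf)) => //.
  by move=> k x a /=; rewrite hv hu.
move=> [w [Zw Bw sw]].
exists (fun k => u i (w k)); split=> [k|a Ba|z Zz].
- exact: tens_cycles_map hf hu du (Zw k).
- apply: Bw.
  (* Applying [v] to the boundary gives a boundary, which differs from the combination of the [w k]
     by the boundary [Bs]. *)
  have Bva : tens_boundaries (C := C) (i := i) j
      (v i (\sum_k (a k)%:MP *: u i (w k))) by apply: tens_boundaries_map hg hv dv _.
  have Bs : tens_boundaries (C := C) (i := i) j
      (\sum_k (a k)%:MP *: (v i (u i (w k)) - w k)).
    by apply: tens_boundaries_sum => k; apply: vu.
  have := tens_boundariesP (-1) Bva Bs; rewrite mpolyCN mpolyC1 scaleN1r.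
  rewrite raddf_sum -sumrB; congr tens_boundaries; apply: eq_bigr => k _ /=.
  by rewrite linearZ /= scalerBr opprB addrC subrK.
- have [a Ba] := sw _ (tens_cycles_map hg hv dv Zz); exists a.
  have := tens_boundariesP (-1) (tens_boundaries_map hf hu du Ba) (uv _ Zz).
  rewrite mpolyCN mpolyC1 scaleN1r raddfB raddf_sum /= opprB.
  rewrite addrC addrA subrK; congr tens_boundaries; congr (_ - _).
  by apply: eq_bigr => k _; rewrite linearZ.
Qed.

End Compare.

(** * Reduction of free modules modulo the variables *)

Section Reduction.
Variables (K : fieldType) (c : nat).

Section Pure.
Variables (D : oi_gens) (n : nat).
Local Notation S := {mpoly K[c * n]}.
Local Notation k0 := (residue_gmod K (c * n)).
Local Notation free := (free_gmod K c D n).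

(** A model of the tensor product of the free module with [K], as [tpure_univ] confirms; polynomials
    act through their constant terms. *)
Definition tmod := {ffun basis D n -> residue_field K (c * n)}.

Definition tpure (x : free) (a : k0) : tmod :=
  [ffun b => ((x : fmod K c D n) b : S) *: (a : residue_field K (c * n))].

Fact tpure_bilinear :
  bilinear_for (GRing.Scale.Law.clone _ _ *:%R _)
    (GRing.Scale.Law.clone _ _ *:%R _) tpure.
Proof.
split=> [a|x] s y z; apply/ffunP => b; rewrite !ffunE.
  by rewrite scalerDl scalerA.
by rewrite scalerDr !scalerA mulrC.
Qed.

HB.instance Definition _ := bilinear_isBilinear.Build _ _ _ _ _ _ tpure tpure_bilinear.

Lemma tmod_sumE (I : Type) (s : seq I) (P : pred I) (F : I -> tmod) b :
  (\sum_(i <- s | P i) F i) b = \sum_(i <- s | P i) F i b.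
Proof. by elim/big_rec2: _ => [|i x y _ <-]; rewrite ffunE. Qed.

Lemma tmod_decomp (z : tmod) : z = \sum_b tpure (fdelta K c b) (z b).
Proof.
apply/ffunP => b; rewrite tmod_sumE (bigD1 b) //= big1 => [|b' /negbTE bb].
  by rewrite !ffunE eqxx scale1r addr0.
by rewrite !ffunE eq_sym bb scale0r.
Qed.

Lemma tpure_univ : is_tensor tpure.
Proof.
move=> U f; pose g (z : tmod) : U := \sum_b f (fdelta K c b) (z b).
have glin : linear g.
  move=> a x y; rewrite /g scaler_sumr -big_split; apply: eq_bigr => b _ /=.
  by rewrite !ffunE linearPr.
exists (HB.pack_for {linear tmod -> U} g (GRing.isLinear.Build S tmod U _ g glin)); split.
  move=> x a; rewrite /= /g [in RHS](fmod_decomp x) linear_sumlz.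
  apply: eq_bigr => b _; rewrite ffunE linearZr_LR.
  by rewrite (linearZl_LR f).
move=> g' hg z; rewrite {1}[z]tmod_decomp raddf_sum.
by apply: eq_bigr => b _; apply: hg.
Qed.

(** Since [K] sits in degree 0 and the variables act by zero, only the degrees of the generators
    remain visible. This is the source of the finiteness of the set of degrees. *)
Lemma tensor_homogP j (z : tmod) : tensor_homog (A := free) (B := k0) tpure j z <->
  forall b, z b != 0 -> bdeg b = j.
Proof.
split=> [[s [hs ->]] b|h].
  rewrite tmod_sumE => hz.
  have [u us hu] : exists2 u, u \in s & tpure u.1 u.2 b != 0.
    apply: contrapT => hn; case/eqP: hz; rewrite big_seq big1 // => u us.
    by apply/eqP; apply: contraT => hu; case: hn; exists u.
  have [d [e [hd he <-]]] := hs u us; move: hu.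
  rewrite ffunE [_ *: _]/(_.@[fun=> 0] * _) meval0E mulf_eq0 negb_or => /andP[h1 h2].
  rewrite -(hd _ _ h1) mdeg0 add0r; case: he => [->|e0]; first by rewrite addr0.
  by rewrite e0 eqxx in h2.
exists [seq (fdelta K c b, z b) | b <- enum {: basis D n} & z b != 0]; split.
  move=> u /mapP[b + ->]; rewrite mem_filter => /andP[hb _].
  by exists (bdeg b), 0; split; [exact: fdelta_part | left | rewrite addr0 h].
rewrite big_map big_filter big_enum_cond {1}[z]tmod_decomp [RHS]big_mkcond.
by apply: eq_bigr => b _ /=; case: eqP => // ->; rewrite linear0r.
Qed.

End Pure.

Definition tpush D m n (e : morph OI m n) (z : tmod D m) : tmod D n :=
  [ffun b => \sum_(b' | bmap e b' == b) (z b' : K) : residue_field K (c * n)].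

Lemma tpush_bmap D m n (e : morph OI m n) (z : tmod D m) b :
  tpush e z (bmap e b) = z b :> K.
Proof.
by rewrite ffunE (big_pred1 b) // => b' /=; rewrite (inj_eq (@bmap_inj _ _ _ e)).
Qed.

Lemma tpush_neq0 D m n (e : morph OI m n) (z : tmod D m) b' : tpush e z b' != 0 ->
  exists2 b, b' = bmap e b & z b != 0.
Proof.
rewrite ffunE => h; apply: contrapT => hn; case/eqP: h.
rewrite big1 // => b /eqP eb; apply/eqP; apply: contraT => hz.
by case: hn; exists b.
Qed.

Lemma tpushD D m n (e : morph OI m n) : {morph @tpush D m n e : x y / x + y}.
Proof.
move=> x y; apply/ffunP => b; rewrite !ffunE -big_split /=.
by apply: eq_bigr => b' _; rewrite ffunE.
Qed.

Lemma tpush0 D m n (e : morph OI m n) : tpush e (0 : tmod D m) = 0.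
Proof. by apply/ffunP => b; rewrite !ffunE big1 // => b' _; rewrite ffunE. Qed.

Lemma tpush_sum D m n (e : morph OI m n) (I : Type) (s : seq I) (F : I -> tmod D m) :
  tpush e (\sum_(i <- s) F i) = \sum_(i <- s) tpush e (F i).
Proof. by apply: big_morph; [apply: tpushD | apply: tpush0]. Qed.

(** Pushing preserves constant terms, so it descends to the reduction modulo the variables. *)
Lemma tpush_pure D m n (e : morph OI m n) (x : free_gmod K c D m) (a : K) :
  tpush e (tpure x (a : residue_field K _)) =
  tpure (fpush e x : free_gmod K c D n) (a : residue_field K _).
Proof.
apply/ffunP => b0; have [[b ->]|nb] := pselect (exists b, b0 = bmap e b).
  rewrite tpush_bmap !ffunE fpush_bmap /GRing.scale /= /residue_scale.
  by rewrite push_meval0.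
rewrite !ffunE fpush_out; last by move=> b eb; apply: nb; exists b.
rewrite scale0r big1 // => b /eqP eb; by case: nb; exists b.
Qed.

Section Diff.
Variables (D D' : oi_gens) (v : forall k : gen_idx D', free_imodule K c D (gen_width k)).

Definition tdiff n (z : tmod D' n) : tmod D n :=
  \sum_b tpure (free_ext v (fdelta K c b : free_gmod K c D' n) : free_gmod K c D n) (z b).

Lemma tdiff_linear n : linear (@tdiff n).
Proof.
move=> a x y; rewrite /tdiff scaler_sumr -big_split; apply: eq_bigr => b _ /=.
by rewrite !ffunE linearPr.
Qed.

HB.instance Definition _ n := GRing.isLinear.Build {mpoly K[c * n]}
  (tmod D' n) (tmod D n) _ (@tdiff n) (@tdiff_linear n).

Lemma tdiff_pure n (x : free_gmod K c D' n) a :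
  tdiff (tpure x a) = tpure (free_ext v x : free_gmod K c D n) a.
Proof.
rewrite /tdiff {2}/free_ext linear_sumlz; apply: eq_bigr => b _.
by rewrite ffunE linearZr_LR (linearZl_LR (@tpure D n)) free_ext_delta.
Qed.

(** This makes cycles and boundaries stable under OI-morphisms. *)
Lemma tdiff_push m n (e : morph OI m n) (z : tmod D' m) :
  tdiff (tpush e z) = tpush e (tdiff z).
Proof.
rewrite [z]tmod_decomp tpush_sum !raddf_sum tpush_sum.
apply: eq_bigr => b _ /=; rewrite tpush_pure !tdiff_pure free_ext_push.
by rewrite -tpush_pure.
Qed.

End Diff.
End Reduction.

(** * Counting leading terms *)

Lemma count_basis_evpoly (D : oi_gens) (U : forall n, basis D n -> Prop) :
  (forall m n (e : morph OI m n) b, U m b -> U n (bmap e b)) ->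
  evpoly (fun n => #|[pred b : basis D n | `[< U n b >]]|).
Proof.
move=> hU; pose V k n (p : morph OI (gen_width k) n) :=
  U n (Tagged (fun k => morph OI (gen_width k) n) p).
apply: (@eq_evpoly (fun n => \sum_(k : gen_idx D) #|[pred p | `[< V k n p >]]|)%N).
  move=> n; rewrite -sum1_card; under eq_bigr do rewrite -sum1_card.
  rewrite sig_big_dep /=; apply: eq_bigl => -[k p] /=.
  by rewrite !inE /V.
apply: evpoly_sum => k; apply: count_morph_evpoly => m n e p; apply: (hU m n e).
Qed.

Section Betti.
Variables (K : fieldType) (c : nat) (D : oi_gens).

(** The term order at the trivial monomial, so that [act_lt] also covers the reduction. *)
Definition basis_lt n (b b' : basis D n) :=
  term_lt (b, 0%MM : 'X_{1..c * n}) (b', 0%MM : 'X_{1..c * n}).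

Definition tcoef n (b : basis D n) (z : tmod K c D n) : K := z b.

Lemma basis_lt_bmap m n (e : morph OI m n) b b' :
  basis_lt b b' -> basis_lt (bmap e b) (bmap e b').
Proof. by move=> /(act_lt e 0%MM); rewrite /act /= !pushm0 add0m. Qed.

Definition is_bterm n (z : tmod K c D n) b := is_lead (@basis_lt n) (@tcoef n) z b.

Lemma is_bterm_push m n (e : morph OI m n) z b : is_bterm z b ->
  is_bterm (tpush e z) (bmap e b).
Proof.
move=> [zb hb]; split; first by rewrite /tcoef tpush_bmap.
move=> s /tpush_neq0[b' -> zb'] ne; apply/basis_lt_bmap/hb => //.
by apply: contraNneq ne => ->.
Qed.

(** The leading terms of [Z] and of [B] each form a family closed under [bmap], and [h] is the
    difference of their counts. The last clause confines nonzero values to degrees of generators. *)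
Lemma subquotient_dim_evpoly (Z B : forall n, tmod K c D n -> Prop) (j : int) :
  (forall n, Z n 0) -> (forall n, B n 0) ->
  (forall n x y a, Z n x -> Z n y -> Z n (x + a%:MP *: y)) ->
  (forall n x y a, B n x -> B n y -> B n (x + a%:MP *: y)) ->
  (forall n x, B n x -> Z n x) ->
  (forall m n (e : morph OI m n) z, Z m z -> Z n (tpush e z)) ->
  (forall m n (e : morph OI m n) z, B m z -> B n (tpush e z)) ->
  (forall n z b, Z n z -> z b != 0 -> bdeg b = j) ->
  exists h : nat -> nat, [/\ evpoly h,
    forall n, has_subquotient_dim (Z n) (B n) (h n) &
    (forall k : gen_idx D, gen_deg k != j) -> forall n, h n = 0%N].
Proof.
move=> Z0 B0 ZD BD BZ Zp Bp Zj.
pose LZ n := [pred b : basis D n | `[< exists2 z, Z n z & is_bterm z b >]].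
pose LB n := [pred b : basis D n | `[< exists2 z, B n z & is_bterm z b >]].
have /choice[h hh] : forall n, exists b, (b + #|LB n| = #|LZ n|)%N /\
    has_subquotient_dim (Z n) (B n) b.
  move=> n; apply: (@subquotient_dim_lead K (c * n) (tmod K c D n) _
    (@basis_lt n) (@tcoef n) _ _ _ _ _ _ _ (basis D n) id) => //.
  - by move=> b; apply: term_lt_irr.
  - by move=> b b' b''; apply: term_lt_trans.
  - by move=> b b' bb; apply: term_lt_total; apply: contraNneq bb => -[->].
  - by move=> b x y; rewrite /tcoef ffunE.
  - move=> b a x; rewrite /tcoef ffunE.
    by rewrite [_ *: _]/(_.@[fun=> 0] * _) mevalC.
  - by move=> x hx; apply/ffunP => b; rewrite ffunE; apply: hx.
  - by move=> x; exists (enum {: basis D n}) => b _; rewrite mem_enum.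
  - by move=> x t _ _; exists t.
  - exact: ZD.
  - exact: BD.
  - exact: BZ.
exists h; split.
- apply: (evpolyB (h1 := fun n => #|LB n|) (h2 := fun n => #|LZ n|)).
  + by move=> n; case: (hh n).
  + apply: count_basis_evpoly => m n e b [z Bz lz].
    by exists (tpush e z); [apply: Bp | apply: is_bterm_push].
  + apply: count_basis_evpoly => m n e b [z Zz lz].
    by exists (tpush e z); [apply: Zp | apply: is_bterm_push].
- by move=> n; case: (hh n).
- move=> hj n; have [e _] := hh n; suff z0 : #|LZ n| = 0%N.
    by move: e; rewrite z0 => /eqP; rewrite addn_eq0 => /andP[/eqP].
  apply: eq_card0 => b; rewrite !inE; apply/asboolP => -[z Zz [zb _]].
  by have := hj (tag b); rewrite -[gen_deg _]/(bdeg b) (Zj n z b Zz zb) eqxx.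
Qed.

End Betti.

(** * Betti numbers of OI-modules *)

Section Resolution.
Variables (K : fieldType) (c : nat).

Lemma kernel_gens (X : graded_imodule OI K c) (D : oi_gens)
    (v : forall k : gen_idx D, X (gen_width k)) :
  (forall k, gpart (gen_deg k) (v k)) ->
  exists (D' : oi_gens) (u : forall k : gen_idx D', free_imodule K c D (gen_width k)),
    (forall k, gpart (gen_deg k) (u k)) /\
    forall n (f : free_gmod K c D n), free_ext v f = 0 <-> exists g, f = free_ext u g.
Proof.
move=> hv.
pose Q n (f : free_imodule K c D n) := free_ext v (f : free_gmod K c D n) = 0.
have subQ : is_submodule Q.
  split; rewrite /Q.
  - by move=> n; rewrite raddf0.
  - by move=> n q r hq hr; rewrite raddfD /= hq hr addr0.
  - by move=> n a q hq; rewrite free_extZ hq scaler0.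
  - by move=> m n e q hq; rewrite free_ext_push hq imap0.
have grQ n q : Q n q -> exists (s : seq int) (y : int -> free_imodule K c D n),
     [/\ forall d, gpart d (y d), forall d, Q n (y d) & q = \sum_(d <- s) y d].
  move=> Qq; have [s [y [us hy eq]]] := gr_sum_uniq (M := free_gmod K c D n) q.
  (* The images of the components are homogeneous of distinct degrees with sum zero, so each of them
     vanishes. *)
  have Qy d : d \in s -> Q n (y d).
    apply: (gr_direct (gpartP (X n)) us (y := fun d => free_ext v (y d))).
      by move=> e; apply: free_ext_homog.
    by rewrite -[RHS]Qq eq raddf_sum.
  (* [noetherian] asks for a component in [Q] at every degree, also outside [s], where [y] is
     uncontrolled. *)
  exists s, (fun d => if d \in s then y d else 0); split=> [d|d|].
  - by case: ifP => // _; apply: (gr0 (gpartP _)).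
  - by case: ifP => [/Qy //|_]; rewrite /Q raddf0.
  - by rewrite eq; apply: eq_big_seq => d ->.
have [D' [u [hu Qu su]]] := noetherian subQ grQ.
exists D', u; split=> // n f; split=> [/su[g <-]|[g ->]]; first by exists g.
rewrite [free_ext u g]/free_ext raddf_sum big1 // => b _ /=.
by rewrite free_extZ (sub_map subQ (tagged b) (Qu (tag b))) scaler0.
Qed.

(** The state of the recursion that builds the resolution: one differential with source and target.
    The next one generates its kernel, so the source becomes the new target. *)
Record gens_map := GensMap {
  gm_cod : oi_gens;
  gm_dom : oi_gens;
  gm_val : forall k : gen_idx gm_dom, free_imodule K c gm_cod (gen_width k);
  gm_homog : forall k, gpart (gen_deg k) (gm_val k)
}.

(** The new generators are the homogeneous components of the given ones, indexed by pairs of a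
    generator and a position in its list of degrees. *)
Lemma homogeneous_generators (M : graded_imodule OI K c) : finitely_generated M ->
  exists (D : oi_gens) (v : forall k : gen_idx D, M (gen_width k)),
    (forall k, gpart (gen_deg k) (v k)) /\
    forall n (q : M n), exists f, free_ext v f = q.
Proof.
move=> [r [w [g hg]]].
have /choice_dep[s /choice_dep[y hy]] := fun k => gr_sum_uniq (g k).
pose D := @OIGens {k : 'I_r & 'I_(size (s k))} (fun i => w (tag i))
  (fun i => nth 0 (s (tag i)) (tagged i)).
pose v (i : gen_idx D) : M (gen_width i) := y (tag i) (nth 0 (s (tag i)) (tagged i)).
exists D, v; split=> [i|n q]; first by case: (hy (tag i)).
pose Q n (q : M n) := exists f, free_ext v f = q.
have subQ : is_submodule Q.
  split.
  - by move=> m; exists 0; rewrite raddf0.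
  - by move=> m x z [f <-] [f' <-]; exists (f + f'); rewrite raddfD.
  - by move=> m a x [f <-]; exists (a *: (f : fmod K c D m)); rewrite free_extZ.
  - by move=> m p e x [f <-]; exists (fpush e f); rewrite free_ext_push.
apply: (hg Q subQ) => k.
have [_ _ ->] := hy k; rewrite (big_nth 0) big_mkord.
apply: (big_ind (Q (w k))); [exact: (sub0 subQ) | exact: (subD subQ) |] => j _.
pose i : gen_idx D := Tagged (fun k => 'I_(size (s k))) j.
exists (fdelta K c
  (existT (fun i : gen_idx D => morph OI (gen_width i) (w k)) i (morph_id OI _))).
by rewrite free_ext_delta /= imap_id.
Qed.

Lemma free_oi_resolution (M : graded_imodule OI K c) : finitely_generated M ->
  exists (D : nat -> oi_gens) (v0 : forall i : gen_idx (D 0%N), M (gen_width i))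
    (v : forall k (i : gen_idx (D k.+1)), free_imodule K c (D k) (gen_width i)),
  [/\ forall i, gpart (gen_deg i) (v0 i), forall k i, gpart (gen_deg i) (v k i),
    forall n (q : M n), exists f, free_ext v0 f = q,
    forall n (f : free_gmod K c (D 0%N) n),
      free_ext v0 f = 0 <-> exists g, f = free_ext (v 0%N) g
    & forall k n (f : free_gmod K c (D k.+1) n),
      free_ext (v k) f = 0 <-> exists g, f = free_ext (v k.+1) g].
Proof.
move=> /homogeneous_generators[D0 [v0 [hv0 sv0]]].
have [D1 [v1 [hv1 ev1]]] := kernel_gens hv0.
have /choice_dep[D2 /choice_dep[u hu]] := fun g : gens_map => kernel_gens (@gm_homog g).
pose step g := @GensMap (gm_dom g) (D2 g) (u g) (hu g).1.
pose st := fix st k := if k is k'.+1 then step (st k') else @GensMap D0 D1 v1 hv1.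
exists (fun k => gm_cod (st k)), v0, (fun k => @gm_val (st k)); split=> //.
  by move=> k i; apply: (@gm_homog (st k)).
by move=> k n f; apply: (hu (st k)).2.
Qed.

(** * The resolution at a fixed width and its Betti numbers *)

Section AtLevel.
Variables (M : graded_imodule OI K c) (D : nat -> oi_gens).
Variables (v0 : forall i : gen_idx (D 0%N), M (gen_width i)).
Variables (v : forall k (i : gen_idx (D k.+1)), free_imodule K c (D k) (gen_width i)).
Hypothesis hv0 : forall i, gpart (gen_deg i) (v0 i).
Hypothesis hv : forall k i, gpart (gen_deg i) (@v k i).
Hypothesis sv0 : forall n (q : M n), exists f, free_ext v0 f = q.
Hypothesis ev0 : forall n (f : free_gmod K c (D 0%N) n),
  free_ext v0 f = 0 <-> exists g, f = free_ext (@v 0%N) g.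
Hypothesis ev : forall k n (f : free_gmod K c (D k.+1) n),
  free_ext (@v k) f = 0 <-> exists g, f = free_ext (@v k.+1) g.

Definition oi_resolution n : graded_free_resolution (M n) :=
  @GradedFreeResolution K (c * n) (M n) (fun k => free_gmod K c (D k) n)
    (fun k => (@free_ext K c (D k.+1) (free_imodule K c (D k)) (@v k) n :
      {linear free_gmod K c (D k.+1) n -> free_imodule K c (D k) n}))
    (@free_ext K c (D 0%N) M v0 n)
    (fun k => @free_graded_free K c (D k) n)
    (fun k => free_ext_homog (@hv k)) (free_ext_homog hv0)
    (@sv0 n) (@ev0 n) (fun k => @ev k n).

Definition oi_tensored n : tensored_complex (oi_resolution n) (residue_gmod K (c * n)) :=
  @TensoredComplex K (c * n) (M n) (oi_resolution n) (residue_gmod K (c * n))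
    (fun k => tmod K c (D k) n) (fun k => @tpure K c (D k) n)
    (fun k => @tdiff K c (D k) (D k.+1) (@v k) n)
    (fun k => @tpure_univ K c (D k) n) (fun k => @tdiff_pure K c (D k) (D k.+1) (@v k) n).

Lemma homog_push D' m n (e : morph OI m n) j z :
  tensor_homog (A := free_gmod K c D' m) (B := residue_gmod K (c * m)) (@tpure K c D' m) j z ->
  tensor_homog (A := free_gmod K c D' n) (B := residue_gmod K (c * n)) (@tpure K c D' n) j
    (tpush e z).
Proof.
move=> /tensor_homogP hz; apply/tensor_homogP => b' /tpush_neq0[b -> zb].
exact: hz zb.
Qed.

Lemma oi_betti i j : exists h : nat -> nat, [/\ evpoly h,
    forall n, has_betti (M n) i j (h n) &
    (forall k : gen_idx (D i), gen_deg k != j) -> forall n, h n = 0%N].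
Proof.
pose Z n : tmod K c (D i) n -> Prop := tens_cycles (C := oi_tensored n) (i := i) j.
pose B n : tmod K c (D i) n -> Prop := tens_boundaries (C := oi_tensored n) (i := i) j.
have [||||||||h [eh hh h0]] := @subquotient_dim_evpoly K c (D i) Z B j.
- by move=> n; apply: tens_cycles0.
- by move=> n; apply: tens_boundaries0.
- by move=> n x y a; apply: tens_cyclesP.
- by move=> n x y a; apply: tens_boundariesP.
- by move=> n x; apply: tens_boundaries_cycles.
- move=> m n e z [hz cz]; split; first exact: homog_push hz.
  case: i @Z @B z {hz} cz => [//|i] Z B z /= cz.
  by rewrite tdiff_push cz tpush0.
- move=> m n e z [w hw ->]; exists (tpush e w); first exact: homog_push hw.
  by rewrite /= tdiff_push.
- by move=> n z b [/tensor_homogP hz _]; apply: hz.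
exists h; split=> // n F C.
(* The dimension passes from the OI-resolution to the arbitrary data [F] and [C] demanded by
   [has_betti]. *)
exact: (@subquotient_dim_indep K (c * n) (M n) _ (oi_resolution n) F
  (oi_tensored n) C i j _ (hh n)).
Qed.

End AtLevel.
End Resolution.

(** * Restriction from FI to OI *)

Section Restriction.

Fact morph_FI_subproof m n (e : morph OI m n) : is_morphism FI (val e).
Proof. exact/injectiveP/(@morph_inj _ _ _ e). Qed.

Definition morph_FI m n (e : morph OI m n) : morph FI m n := Sub _ (morph_FI_subproof e).

Lemma morph_FI_id n : morph_FI (morph_id OI n) = morph_id FI n.
Proof. exact: val_inj. Qed.

Lemma morph_FI_comp m n p (g : morph OI n p) (f : morph OI m n) :
  morph_FI (morph_comp g f) = morph_comp (morph_FI g) (morph_FI f).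
Proof. exact: val_inj. Qed.

(** [f] enumerates the image of [e] in increasing order, and [s] is the permutation that restores
    the order of the values of [e]. *)
Lemma morph_FI_factor m n (e : morph FI m n) : exists (f : morph OI m n) (s : morph FI m m),
  e = morph_comp (morph_FI f) s.
Proof.
have [||f hf] := @ex_word_of m n [seq mcodom e y | y <- enum 'I_n].
- by rewrite size_map size_enum_ord.
- by rewrite count_map -[RHS](card_mcodom e) cardE size_filter -enumT.
have ef y : mcodom f y = mcodom e y.
  by rewrite -nth_word_of hf (nth_map y) ?size_enum_ord // nth_ord_enum.
have /fin_all_exists[s hs] (x : 'I_m) : exists y, morph_fun e x = morph_fun f y.
  by apply/mcodomP; rewrite ef; apply/mcodomP; exists x.
have s_inj : is_morphism FI (finfun s).
  apply/injectiveP => x y; rewrite !ffunE => sxy.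
  by apply: (@morph_inj _ _ _ e); rewrite !hs sxy.
exists f, (Sub _ s_inj); apply: morph_ext => x.
by rewrite morph_compE hs /morph_fun /= ffunE.
Qed.

Variables (K : fieldType) (c : nat) (M : graded_imodule FI K c).

(** The modules at each width stay those of [M]. The definition is transparent, so that statements
    about Betti numbers of the restriction are convertible with those for [M]. *)
Definition restrict_OI : graded_imodule OI K c.
Proof.
refine (@GradedIModule OI K c M (fun m n e => imap (morph_FI e)) _ _ _ _ _).
- by move=> m n e q r; apply: imapD.
- by move=> m n e a q; apply: imapZ.
- by move=> n q; rewrite morph_FI_id imap_id.
- by move=> m n p g f q; rewrite morph_FI_comp imap_comp.
- by move=> m n e d q; apply: imap_homog.
Defined.

Lemma restrict_OI_fg : finitely_generated M -> finitely_generated restrict_OI.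
Proof.
move=> [r [w [g hg]]].
pose T := {k : 'I_r & morph FI (w k) (w k)}.
exists #|{: T}|, (fun i => w (tag (enum_val i))),
  (fun i => imap (tagged (enum_val i)) (g (tag (enum_val i)))) => Q subQ Qg.
have Qt (t : T) : Q (w (tag t)) (imap (tagged t) (g (tag t))).
  by rewrite -(enum_rankK t); apply: Qg.
(* The largest FI-submodule contained in [Q]. It contains every [g k], because an FI-morphism is a
   permutation followed by an OI-morphism. *)
pose Q' n (q : M n) := forall p (e : morph FI n p), Q p (imap e q).
have imapM0 p m (e : morph FI p m) : imap e (0 : M p) = 0.
  by rewrite -(scale0r (0 : M p)) imapZ push0 scale0r.
have subQ' : is_submodule Q'.
  split.
  - by move=> n p e; rewrite imapM0; apply: (sub0 subQ).
  - by move=> n x y hx hy p e; rewrite imapD; apply: (subD subQ).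
  - by move=> n a x hx p e; rewrite imapZ; apply: (subZ subQ).
  - by move=> m n e x hx p e'; rewrite -imap_comp.
move=> n q; rewrite -(imap_id q); apply: (hg Q' subQ') => k p e.
have [f [s ->]] := morph_FI_factor e; rewrite imap_comp.
apply: (sub_map subQ f); exact: (Qt (existT (fun k => morph FI (w k) (w k)) k s)).
Qed.

End Restriction.

Lemma betti_evpoly (C : index_category) (K : fieldType) (c : nat) (M : graded_imodule C K c)
    (i : nat) : finitely_generated M ->
  exists (s : seq int) (h : int -> nat -> nat),
    [/\ forall j, evpoly (h j), forall j n, has_betti (M n) i j (h j n)
      & forall j, j \notin s -> forall n, h j n = 0%N].
Proof.
have oi (M' : graded_imodule OI K c) : finitely_generated M' ->
  exists (s : seq int) (h : int -> nat -> nat),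
    [/\ forall j, evpoly (h j), forall j n, has_betti (M' n) i j (h j n)
      & forall j, j \notin s -> forall n, h j n = 0%N].
  move=> /free_oi_resolution[D [v0 [v [hv0 hv sv0 ev0 ev]]]].
  have /choice[h hh] := oi_betti hv0 hv sv0 ev0 ev i.
  exists [seq gen_deg k | k <- enum (gen_idx (D i))], h; split=> [j|j n|j js].
  - by case: (hh j).
  - by case: (hh j).
  - case: (hh j) => _ _; apply=> k; apply: contraNneq js => <-.
    by apply: map_f; rewrite mem_enum.
case: C M => [|M /restrict_OI_fg/oi //]; exact: oi.
Qed.

Theorem theorem6p5 (K : fieldType) (c : nat) (c_ge1 : (1 <= c)%N)
    (C : index_category) (M : graded_imodule C K c) (M_fg : finitely_generated M)
    (i : nat) :
  exists (l : nat) (j : 'I_l -> int) (p : 'I_l -> {poly rat}),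
    (forall k1 k2 : 'I_l, (k1 < k2)%N -> j k1 < j k2) /\
    exists n0 : nat, forall n : nat, (n0 <= n)%N ->
      (forall d : int, (forall k, d <> j k) -> has_betti (M n) i d 0) /\
      (forall k : 'I_l, exists2 b : nat,
         b%:R = (p k).[n%:R] & has_betti (M n) i (j k) b).
Proof.
have [s [h [/choice[p /choice[N hN]] hb h0]]] := betti_evpoly i M_fg.
pose t := sort <=%O (undup s).
have lt_t : sorted <%O t by rewrite sort_lt_sorted undup_uniq.
exists (size t), (fun k => nth 0 t k), (fun k => p (nth 0 t k)); split.
  move=> k1 k2 k12; rewrite (sorted_ltn_nth lt_trans) // inE; exact: ltn_ord.
(* Each degree has its own threshold; a common one exists because only the finitely many degrees in
   [t] matter, the others having Betti number zero at every [n]. *)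
exists (\max_(k < size t) N (nth 0%R t k))%N => n hn; split=> [d hd|k].
  rewrite -(h0 d _ n) //; apply/negP => ds.
  have dt : d \in t by rewrite mem_sort mem_undup.
  have it : (index d t < size t)%N by rewrite index_mem.
  by apply: (hd (Ordinal it)); rewrite /= nth_index.
exists (h (nth 0 t k) n) => //; apply: hN; apply: leq_trans hn.
exact: (leq_bigmax k).
Qed.
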